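(* Let $G$ be a finite simple graph of order $n\geq 5$ whose adjacency matrix $A(G)$ is non-singular, and suppose its largest adjacency eigenvalue satisfies $\lambda_1\leq 7.11$. Then $\mathcal{E}(G)\geq n-1+\bar{d}$.
   Context: For a finite simple graph $G$ with $n$ vertices and $m$ edges, $A(G)$ is its adjacency matrix with eigenvalues $\lambda_1\ge\cdots\ge\lambda_n$, and the energy is $\mathcal{E}(G)=\sum_{i=1}^n|\lambda_i|$. $G$ is non-singular if $A(G)$ is non-singular. $\bar d=2m/n$ is the average degree. *)

(* Defs.v *)
From HB Require Import structures.
From mathcomp Require Import all_boot all_order all_algebra.
From mathcomp Require Import reals.
Set Implicit Arguments. Unset Strict Implicit. Unset Printing Implicit Defensive.
Import Order.TTheory GRing.Theory Num.Theory.
Local Open Scope ring_scope.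

Definition simple_graph (n : nat) (e : rel 'I_n) : Prop :=
  symmetric e /\ irreflexive e.

Definition adjmx (R : realType) (n : nat) (e : rel 'I_n) : 'M[R]_n :=
  \matrix_(i, j) (e i j)%:R.

Definition nedges (n : nat) (e : rel 'I_n) : nat :=
  #|[set p : 'I_n * 'I_n | (p.1 < p.2)%N && e p.1 p.2]|.

Definition is_spectrum (R : realType) (n : nat) (A : 'M[R]_n) (s : seq R) : Prop :=
  char_poly A = \prod_(x <- s) ('X - x%:P).

Definition energy_of (R : realType) (s : seq R) : R := \sum_(x <- s) `|x|.

(* Main.v *)
Require Import Defs.
From HB Require Import structures.
From mathcomp Require Import all_boot all_order all_algebra.
From mathcomp Require Import ring lra zify.
From mathcomp Require Import boolp functions reals interval_inference topology normedtype derive realfun exp.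
Set Implicit Arguments. Unset Strict Implicit. Unset Printing Implicit Defensive.
Import Order.TTheory GRing.Theory Num.Theory.
Import numFieldNormedType.Exports.
Local Open Scope ring_scope.

(* Write d for the average degree, L for the largest eigenvalue and E for the
   energy. As det A is a nonzero integer, the sum of the ln |lam_i| is
   nonnegative; with slack c t = t - 1 - c (t^2 - 1) - (1 - 2 c) ln t and
   sum lam_i^2 = n d this gives, for every c <= 1/2,
     E - (n - 1 + d) >= sum_i slack c |lam_i| + (c n - 1) (d - 1).
   For c < 1/4, slack c is nonnegative on ]0, T] as soon as slack c T >= 0.

   If n >= 11, take c = 1/11 and T = 7.11 >= L >= |lam_i|.

   If n <= 10, then |lam_i| <= n/2 for every eigenvalue other than L, because
   lam_i^2 + L^2 <= n d and d <= L, and c is chosen with slack c (n/2) barely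
   nonnegative. Suppose first that two eigenvalues x, y other than L are
   positive. If E < n - 1 + d then x + y + L < (n - 1 + d) / 2 since the trace
   vanishes, and the terms of L, x and y alone make the bound nonnegative.

   Suppose finally that at most two eigenvalues are positive. Then the quadratic
   form of A is not nonnegative on any three-dimensional space, and this forces
   the complement H of the graph to have no triangle, induced 2 K_2 or induced
   C_5. Hence, for u of maximal degree in H, both N_H(u) and its complement are
   independent in H, that is, cliques of the graph. Now E >= 2 tr (A P) for
   every orthogonal projection P, and projections onto spaces of vectors
   constant on {u}, N_H(u) and the remaining vertices give the bound. *)

(** * Logarithms *)

Lemma is_derive_ndecr (R : realType) (g dg : R -> R) (a b : R) :
  (forall x, a <= x -> x <= b -> is_derive x 1 g (dg x)) ->
  (forall x, a <= x -> x <= b -> 0 <= dg x) ->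
  a <= b -> g a <= g b.
Proof.
move=> dgE dg0; rewrite le_eqVlt => /orP[/eqP-> //|ab].
have [||c cab] := @MVT R g dg a b ab.
- by move=> x; rewrite in_itv /= => /andP[/ltW ? /ltW ?]; apply: dgE.
- apply: derivable_within_continuous => x; rewrite in_itv /= => /andP[ax xb].
  by have := dgE x ax xb => -[].
rewrite -subr_ge0 => ->; apply: mulr_ge0; last by rewrite subr_ge0 ltW.
by move: cab; rewrite in_itv /= => /andP[/ltW ? /ltW ?]; apply: dg0.
Qed.

Lemma is_derive_nincr (R : realType) (g dg : R -> R) (a b : R) :
  (forall x, a <= x -> x <= b -> is_derive x 1 g (dg x)) ->
  (forall x, a <= x -> x <= b -> dg x <= 0) ->
  a <= b -> g b <= g a.
Proof.
move=> dgE dg0 ab; rewrite -lerN2.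
apply: (@is_derive_ndecr R (fun x => - g x) (fun x => - dg x)) => // x ax xb.
  by have := dgE x ax xb => ?; apply: is_deriveN.
by rewrite oppr_ge0 dg0.
Qed.

Lemma ln_le_tangent (R : realType) (y y0 : R) : 0 < y -> 0 < y0 ->
  ln y <= y / y0 - 1 + ln y0.
Proof.
move=> y_gt0 y0_gt0.
have r0 : 0 < y / y0 by rewrite divr_gt0.
have := @le_ln1Dx R (y / y0 - 1).
have -> : 1 + (y / y0 - 1) = y / y0 by ring.
rewrite ln_div ?posrE// => H.
have /H : -1 < y / y0 - 1 by lra.
lra.
Qed.

Lemma is_derive_xlnx (R : realType) (x : R) : 0 < x ->
  is_derive x 1 (fun y : R => y * ln y) (ln x + 1).
Proof.
move=> x0; have ? := is_derive1_ln x0.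
apply: (@is_derive_eq _ _ _ (id * @ln R)).
by rewrite /GRing.scale /= mulfV ?gt_eqF//; ring.
Qed.

(** The second factor vanishes at 1 and has derivative [2 * (x - 1 - ln x)], which is nonnegative,
    so it has the sign of [y - 1]. *)
Lemma ln_pade_aux (R : realType) (y : R) : 0 < y ->
  0 <= (y - 1) * (y ^+ 2 - 1 - 2 * (y * ln y)).
Proof.
move=> y0.
pose xlnx (x : R) := x * ln x.
pose g : R -> R := id ^+ 2 - cst 1 - cst 2 * xlnx.
have g1 : g 1 = 0 by rewrite /g /xlnx !fctE /= ln1; ring.
have dg (x : R) : 0 < x -> is_derive x 1 g (2 * (x - 1 - ln x)).
  move=> x0; have ? : is_derive x 1 xlnx _ := is_derive_xlnx x0.
  by apply: is_derive_eq; rewrite /GRing.scale /=; ring.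
have dg0 (x : R) : 0 < x -> 0 <= 2 * (x - 1 - ln x).
  by move=> x0; have := @ln_le_tangent R x 1 x0 ltr01; rewrite ln1; lra.
have -> : y ^+ 2 - 1 - 2 * (y * ln y) = g y by [].
have [y1|y1] := leP 1 y.
  apply: mulr_ge0; first lra.
  rewrite -g1; apply: (@is_derive_ndecr R g (fun x => 2 * (x - 1 - ln x)) 1 y _ _ y1) => x x1 _.
    by apply: dg; exact: lt_le_trans x1.
  by apply: dg0; exact: lt_le_trans x1.
rewrite -mulrNN; apply: mulr_ge0; first lra.
rewrite oppr_ge0 -g1.
apply: (@is_derive_ndecr R g (fun x => 2 * (x - 1 - ln x)) y 1 _ _ (ltW y1)) => x yx _.
  by apply: dg; exact: lt_le_trans yx.
by apply: dg0; exact: lt_le_trans yx.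
Qed.

(** The quotient of [(y - 1) * (y + 5)] by [4 * y + 2] is the Padé approximant of [ln] at 1 of type
    [2/1]. The difference [g] of the two sides has derivative
    [2 / x * (x ^+ 2 - 1 - 2 * (x * ln x))], whose sign is that of [x - 1], so its minimum is its
    value 0 at 1. *)
Lemma ln_le_pade (R : realType) (y : R) : 0 < y ->
  (4 * y + 2) * ln y <= (y - 1) * (y + 5).
Proof.
move=> y0.
pose xlnx (x : R) := x * ln x.
pose p : R -> R := id ^+ 2 + cst 4 * id - cst 5.
pose q : R -> R := cst 4 * xlnx + cst 2 * @ln R.
pose g : R -> R := p - q.
suff : g 1 <= g y by rewrite /g /p /q /xlnx !fctE /= ln1; lra.
have dg (x : R) : 0 < x ->
    is_derive x 1 g (2 / x * (x ^+ 2 - 1 - 2 * (x * ln x))).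
  move=> x0; have ? : is_derive x 1 xlnx _ := is_derive_xlnx x0.
  have ? := is_derive1_ln x0.
  have xn0 : x != 0 by rewrite gt_eqF.
  have dp : is_derive x 1 p (2 * x + 4).
    by apply: is_derive_eq; rewrite /GRing.scale /=; ring.
  have dq : is_derive x 1 q (4 * (ln x + 1) + 2 / x).
    by apply: is_derive_eq; rewrite /GRing.scale /= !mulr0 !addr0.
  apply: (is_derive_eq (is_deriveB dp dq)).
  by field.
have [y1|y1] := leP 1 y.
  apply: (@is_derive_ndecr R g (fun x => 2 / x * (x ^+ 2 - 1 - 2 * (x * ln x))) 1 y _ _ y1) => x x1 _.
    by apply: dg; exact: lt_le_trans x1.
  have x0 : 0 < x by lra.
  apply: mulr_ge0; first by rewrite divr_ge0 // ltW.
  move: x1; rewrite le_eqVlt => /orP[/eqP<-|x1]; first by rewrite ln1; lra.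
  by have := ln_pade_aux x0; rewrite pmulr_rge0 // subr_gt0.
apply: (@is_derive_nincr R g (fun x => 2 / x * (x ^+ 2 - 1 - 2 * (x * ln x))) y 1 _ _ (ltW y1)) => x yx x1.
  by apply: dg; exact: lt_le_trans yx.
have x0 : 0 < x by lra.
rewrite mulr_ge0_le0 //; first by rewrite divr_ge0 // ltW.
move: x1; rewrite le_eqVlt => /orP[/eqP->|x1]; first by rewrite ln1; lra.
by have := ln_pade_aux x0; rewrite nmulr_rge0 // subr_lt0.
Qed.

(* The logarithms of 16/15, 25/24 and 81/80 determine those of 2, 3 and 5. *)
Lemma ln235 (R : realType) :
  [/\ 131 / 189 <= ln (2 : R) /\ ln (2 : R) <= 61 / 88,
     78 / 71 <= ln (3 : R) /\ ln (3 : R) <= 245 / 223 &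
     581 / 361 <= ln (5 : R) /\ ln (5 : R) <= 272 / 169].
Proof.
have posM (a b : R) : 0 < a -> 0 < b -> ln (a * b) = ln a + ln b.
  by move=> a0 b0; rewrite lnM ?posrE.
have l4 : ln (4 : R) = 2 * ln 2.
  have -> : (4 : R) = 2 * 2 by ring.
  by rewrite posM //; ring.
have l16 : ln (16 : R) = 4 * ln 2.
  have -> : (16 : R) = 4 * 4 by ring.
  by rewrite posM // l4; ring.
have l80 : ln (80 : R) = 4 * ln 2 + ln 5.
  have -> : (80 : R) = 16 * 5 by ring.
  by rewrite posM // l16.
have l15 : ln (15 : R) = ln 3 + ln 5.
  have -> : (15 : R) = 3 * 5 by ring.
  by rewrite posM.
have l24 : ln (24 : R) = 3 * ln 2 + ln 3.
  have -> : (24 : R) = 4 * (2 * 3) by ring.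
  by rewrite posM // posM // l4; ring.
have l25 : ln (25 : R) = 2 * ln 5.
  have -> : (25 : R) = 5 * 5 by ring.
  by rewrite posM //; ring.
have l9 : ln (9 : R) = 2 * ln 3.
  have -> : (9 : R) = 3 * 3 by ring.
  by rewrite posM //; ring.
have l81 : ln (81 : R) = 4 * ln 3.
  have -> : (81 : R) = 9 * 9 by ring.
  by rewrite posM // l9; ring.
have ub (a b : R) : 0 < a -> 0 < b ->
    (4 * (a / b) + 2) * (ln a - ln b) <= (a / b - 1) * (a / b + 5).
  move=> a0 b0; rewrite -ln_div ?posrE //.
  by apply: ln_le_pade; rewrite divr_gt0.
(* Used at a ratio and at its inverse, the upper bound encloses the logarithm from both sides. *)
have := ub 16 15 ltac:(lra) ltac:(lra).
have := ub 15 16 ltac:(lra) ltac:(lra).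
have := ub 25 24 ltac:(lra) ltac:(lra).
have := ub 24 25 ltac:(lra) ltac:(lra).
have := ub 81 80 ltac:(lra) ltac:(lra).
have := ub 80 81 ltac:(lra) ltac:(lra).
rewrite l16 l15 l24 l25 l81 l80 => *.
split; split; [lra|lra|lra|lra|lra|lra].
Qed.

(** * The slack function *)

(** The coefficient of the logarithm is the one that makes 1 a critical point; the other critical
    point is (1 - 2c) / (2c). *)
Definition slack (R : realType) (c t : R) : R :=
  t - 1 - c * (t ^+ 2 - 1) - (1 - 2 * c) * ln t.

Lemma slack1 (R : realType) (c : R) : slack c 1 = 0.
Proof. by rewrite /slack ln1; ring. Qed.

Lemma is_derive_slack (R : realType) (c x : R) : 0 < x ->
  is_derive x 1 (slack c) ((1 - x) * (2 * c * x - (1 - 2 * c)) / x).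
Proof.
move=> x0; have ? := is_derive1_ln x0.
have xn0 : x != 0 by rewrite gt_eqF.
have -> : slack c = id - cst 1 - cst c * (id ^+ 2 - cst 1) -
    cst (1 - 2 * c) * @ln R by apply/funext.
apply: is_derive_eq; rewrite /GRing.scale /=.
by rewrite !mulr0 !addr0 !mulr1 !fctE /=; field.
Qed.

(** As c < 1/4, the critical point (1 - 2c) / (2c) exceeds 1: the function decreases up to 1,
    increases up to that point and decreases afterwards. Its minimum on ]0, T] is therefore its
    value 0 at 1 or its value at T. *)
Lemma slack_ge0 (R : realType) (c T t : R) : 0 < c -> 4 * c < 1 ->
  0 <= slack c T -> 0 < t -> t <= T -> 0 <= slack c t.
Proof.
move=> c0 c4 T0 t0 tT.
pose ds (x : R) := (1 - x) * (2 * c * x - (1 - 2 * c)) / x.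
have dsE (x : R) : 0 < x -> is_derive x 1 (slack c) (ds x) by exact: is_derive_slack.
have [t1|t1] := leP t 1.
  rewrite -(slack1 c).
  apply: (@is_derive_nincr R (slack c) ds t 1 _ _ t1) => x tx x1.
    by apply: dsE; exact: lt_le_trans tx.
  have x0 : 0 <= x^-1 by rewrite invr_ge0; lra.
  have cx : c * x <= c by rewrite ler_piMr // ltW.
  by rewrite /ds mulr_le0_ge0 // mulr_ge0_le0 //; lra.
have [ts|ts] := leP (2 * c * t) (1 - 2 * c).
  rewrite -(slack1 c).
  apply: (@is_derive_ndecr R (slack c) ds 1 t _ _ (ltW t1)) => x x1 xt.
    by apply: dsE; exact: lt_le_trans x1.
  have x0 : 0 <= x^-1 by rewrite invr_ge0; lra.
  have cx : c * x <= c * t by rewrite ler_pM2l.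
  by rewrite /ds mulr_ge0 // -mulrNN mulr_ge0 //; lra.
apply: (le_trans T0).
apply: (@is_derive_nincr R (slack c) ds t T _ _ tT) => x tx xT.
  by apply: dsE; exact: lt_le_trans tx.
have x0 : 0 <= x^-1 by rewrite invr_ge0; lra.
have cx : c * t <= c * x by rewrite ler_pM2l.
by rewrite /ds mulr_le0_ge0 // mulr_le0_ge0 //; lra.
Qed.

(** Let d be half the difference of x and y. Passing from m, m to x, y costs 2 c d^2 in the
    quadratic term, while the logarithm gains at least (1 - 2c) d^2 / m^2. For m <= 1 and c < 1/4
    the gain exceeds the cost. *)
Lemma slack_convex (R : realType) (c x y m : R) : 0 < c -> 4 * c < 1 ->
  0 < x -> 0 < y -> x + y = 2 * m -> m <= 1 ->
  2 * slack c m <= slack c x + slack c y.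
Proof.
move=> c0 c4 x0 y0 xy m1.
have m0 : 0 < m by lra.
have lnxy : ln x + ln y <= (x * y / m ^+ 2 - 1) + (ln m + ln m).
  rewrite -!lnM ?posrE // expr2.
  by apply: ln_le_tangent; rewrite mulr_gt0.
pose d := (x - y) / 2.
have E : x * y / m ^+ 2 - 1 = - (d ^+ 2 / m ^+ 2).
  by rewrite /d (_ : x = 2 * m - y); [field; rewrite gt_eqF | lra].
have dm : d ^+ 2 <= d ^+ 2 / m ^+ 2.
  rewrite ler_pdivlMr ?exprn_gt0 // ler_piMr ?sqr_ge0 //.
  by rewrite expr_le1 // ltW.
have sq : x ^+ 2 + y ^+ 2 = 2 * m ^+ 2 + 2 * d ^+ 2.
  have -> : m = (x + y) / 2 by lra.
  by rewrite /d; field.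
rewrite -subr_ge0.
have -> : slack c x + slack c y - 2 * slack c m =
  (x + y - 2 * m) - c * (x ^+ 2 + y ^+ 2 - 2 * m ^+ 2) +
  (1 - 2 * c) * (2 * ln m - (ln x + ln y)) by rewrite /slack; ring.
rewrite xy sq subrr.
have : (1 - 2 * c) * d ^+ 2 <= (1 - 2 * c) * (2 * ln m - (ln x + ln y)).
  by rewrite ler_pM2l ?subr_gt0; lra.
have := sqr_ge0 d; nra.
Qed.

(** The tangent at a point whose numerator has the exponents a, b, e of 2, 3, 5 and whose
    denominator has a', b', e'; thus [ln_le_smooth 2 2 0 0 0 2] touches at 36/25. The intercept
    involves only the logarithms enclosed by [ln235]. *)
Lemma ln_le_smooth (a b e a' b' e' : nat) (R : realType) (y : R) : 0 < y ->
  ln y <= y * ((2 ^+ a' * 3 ^+ b' * 5 ^+ e') / (2 ^+ a * 3 ^+ b * 5 ^+ e)) - 1 +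
    ((ln 2 * a%:R + ln 3 * b%:R + ln 5 * e%:R) -
     (ln 2 * a'%:R + ln 3 * b'%:R + ln 5 * e'%:R)).
Proof.
move=> y0.
have s0 (i j k : nat) : 0 < (2 ^+ i * 3 ^+ j * 5 ^+ k : R).
  by rewrite !mulr_gt0 ?exprn_gt0.
have lnE (i j k : nat) : ln (2 ^+ i * 3 ^+ j * 5 ^+ k : R) =
    ln 2 * i%:R + ln 3 * j%:R + ln 5 * k%:R.
  by rewrite !lnM ?posrE ?mulr_gt0 ?exprn_gt0 // !lnXn // !mulr_natr.
have := ln_le_tangent y0 (divr_gt0 (s0 a b e) (s0 a' b' e')).
by rewrite invf_div ln_div ?posrE // !lnE.
Qed.

(** The first six pairs (c, T) have T = n/2 for n = 5, ..., 10. The pair (1/6, 5/2) serves sparse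
    graphs of order 6, and (1/11, 711/100) serves n >= 11. *)
Lemma slack_T (R : realType) :
  [/\ 0 <= slack (7 / 41) (5 / 2) :> R, 0 <= slack (25 / 161) 3 :> R,
      0 <= slack (80 / 561) (7 / 2) :> R & 0 <= slack (12 / 91) 4 :> R] /\
  [/\ 0 <= slack (7 / 57) (9 / 2) :> R, 0 <= slack (10 / 87) 5 :> R,
      0 <= slack (1 / 6) (5 / 2) :> R & 0 <= slack (1 / 11) (711 / 100) :> R].
Proof.
have [[] ? ? [] ? ? [] ? ?] := ln235 R.
have posM (a b : R) : 0 < a -> 0 < b -> ln (a * b) = ln a + ln b.
  by move=> a0 b0; rewrite lnM ?posrE.
have lD (a b : R) : 0 < a -> 0 < b -> ln (a / b) = ln a - ln b.
  by move=> a0 b0; rewrite ln_div ?posrE.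
have l52 : ln (5 / 2 : R) = ln 5 - ln 2 by rewrite lD.
have l4 : ln (4 : R) = 2 * ln 2.
  have -> : (4 : R) = 2 * 2 by ring.
  by rewrite posM //; ring.
have l9 : ln (9 : R) = 2 * ln 3.
  have -> : (9 : R) = 3 * 3 by ring.
  by rewrite posM //; ring.
have l92 : ln (9 / 2 : R) = 2 * ln 3 - ln 2 by rewrite lD // l9.
(* The prime 7 is reached through 49/50, which is close to 1. *)
have l7 : 2 * ln (7 : R) <= ln 2 + 2 * ln 5 - 2 / 100.
  have : ln (49 / 50 : R) = 2 * ln 7 - (ln 2 + 2 * ln 5).
    rewrite lD //.
    have -> : (49 : R) = 7 * 7 by ring.
    have -> : (50 : R) = 2 * (5 * 5) by ring.
    by rewrite !posM //; ring.
  have := @ln_le_tangent R (49 / 50) 1; rewrite ln1; lra.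
have l72 : ln (7 / 2 : R) = ln 7 - ln 2 by rewrite lD.
(* 64/9 exceeds 7.11 by only 1/900. *)
have l711 : ln (711 / 100 : R) <= 6 * ln 2 - 2 * ln 3.
  have -> : 6 * ln 2 - 2 * ln 3 = ln (64 / 9 : R).
    rewrite lD // l9.
    have -> : (64 : R) = 4 * (4 * 4) by ring.
    by rewrite !posM // ?l4; ring.
  by rewrite ler_ln ?posrE; lra.
rewrite /slack l52 l4 l92 l72.
by split; split; lra.
Qed.

(* The chord of the square function over [l1, l2] bounds L^2. *)
Lemma slack_le_piece (R : realType) (c l1 l2 L : R) : 0 <= c -> l1 <= L -> L <= l2 ->
  L - 1 - c * ((l1 + l2) * L - l1 * l2 - 1) - (1 - 2 * c) * ln L <= slack c L.
Proof.
move=> c0 l1L Ll2; rewrite /slack lerD2r lerD2l lerN2 ler_wpM2l // lerD2r.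
have : 0 <= (L - l1) * (l2 - L) by rewrite mulr_ge0 ?subr_ge0.
lra.
Qed.

(* By convexity the two arguments may be replaced by their mean, whose square is
   then bounded by a chord on [0, mu]. *)
Lemma slack_le_piece2 (R : realType) (c mu x y : R) : 0 < c -> 4 * c < 1 ->
  mu <= 1 -> 0 < x -> 0 < y -> x + y <= 2 * mu ->
  2 * ((x + y) / 2 - 1 - c * (mu * ((x + y) / 2) - 1) -
       (1 - 2 * c) * ln ((x + y) / 2)) <= slack c x + slack c y.
Proof.
move=> c0 c4 mu1 x0 y0 xy; set m := (x + y) / 2.
apply: (@le_trans _ _ (2 * slack c m)).
  have m0 : 0 <= m by rewrite /m; lra.
  have mmu : m <= mu by rewrite /m; lra.
  by have := slack_le_piece (ltW c0) m0 mmu; rewrite add0r mul0r subr0; lra.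
by apply: slack_convex => //; rewrite /m; lra.
Qed.

Lemma three_pos_piece (R : realType) (c l1 l2 mu L x y k : R) :
  0 < c -> 4 * c < 1 -> mu <= 1 -> 0 < x -> 0 < y -> x + y <= 2 * mu ->
  l1 <= L -> L <= l2 ->
  k <= L - 1 - c * ((l1 + l2) * L - l1 * l2 - 1) - (1 - 2 * c) * ln L +
    2 * ((x + y) / 2 - 1 - c * (mu * ((x + y) / 2) - 1) -
         (1 - 2 * c) * ln ((x + y) / 2)) ->
  k <= slack c L + slack c x + slack c y.
Proof.
move=> c0 c4 mu1 x0 y0 xy lL Ll kle.
have := slack_le_piece2 c0 c4 mu1 x0 y0 xy.
have := slack_le_piece (ltW c0) lL Ll.
by move: kle => /=; lra.
Qed.

(* Superseded bounds on L, x and y are cleared for the speed of lra. *)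
Ltac three_pos_lra l1 l2 mu lnL lnm :=
  match goal with
  | |- is_true (0 <= @slack ?R ?c ?L + slack _ ?x + slack _ ?y + _) =>
    rewrite -lerBlDr;
    apply: (@three_pos_piece _ c l1 l2 mu);
      [clear; lra|clear; lra|clear; lra|assumption|assumption|lra
      |first [assumption|exact: ltW|lra]|first [assumption|lra]|];
    let L0 := fresh in let m0 := fresh in
    have L0 : 0 < L by [apply: (@lt_le_trans _ _ l1); [clear; lra|first [assumption|exact: ltW|lra]]];
    have m0 : 0 < (x + y) / 2 by [rewrite divr_gt0 ?addr_gt0 //; clear; lra];
    have := lnL L L0; have := lnm _ m0; clear L0;
    repeat match goal with
      | H : is_true (_ < x) |- _ => clear H
      | H : is_true (_ < y) |- _ => clear H
      | H : is_true (x <= _) |- _ => clear H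
      | H : is_true (y <= _) |- _ => clear H
      | H : is_true (L <= 711 / 100), H' : is_true (L <= _) |- _ => clear H
      | H : is_true (?a < L), H' : is_true (?b < L) |- _ => clear H
      end;
    have [[] ? ? [] ? ? [] ? ?] := @ln235 R; lra
  end.

(* In each of the next lemmas the range of L is cut into pieces [l1, l2]; ln L and
   ln ((x + y) / 2) are bounded by tangents at 2-3-5-smooth rationals, which
   leaves a linear problem. *)
Lemma three_pos_slack5 (R : realType) (d L x y : R) :
  6 / 5 <= d -> d <= L -> L <= 711 / 100 -> 0 < x -> 0 < y ->
  x + y + L <= (4 + d) / 2 -> x <= (5 / 2) -> y <= (5 / 2) ->
  0 <= slack (7 / 41) L + slack (7 / 41) x + slack (7 / 41) y +
    ((7 / 41) * 5 - 1) * (d - 1).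
Proof.
move=> d1 dL L711 x0 y0 xyL xT yT.
(* Since d <= L, the hypothesis on the sum gives x + y <= (4 - L) / 2, so on a piece starting at l1
   the value (4 - l1) / 4 is admissible for [mu]. The same rule with n - 1 in place of 4 gives [mu]
   for the other orders. *)
have [L1|L1] := leP L (8 / 5).
  three_pos_lra (6 / 5 : R) (8 / 5 : R) (7 / 10 : R)
    (@ln_le_smooth 2 2 0 0 0 2 R) (@ln_le_smooth 4 0 0 0 0 2 R).
have [L2|L2] := leP L (99 / 40).
  three_pos_lra (8 / 5 : R) (99 / 40 : R) (3 / 5 : R)
    (@ln_le_smooth 1 0 0 0 0 0 R) (@ln_le_smooth 3 0 0 0 1 1 R).
have [L3|L3] := leP L (37 / 10).
  three_pos_lra (99 / 40 : R) (37 / 10 : R) (61 / 160 : R)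
    (@ln_le_smooth 3 2 0 0 0 2 R) (@ln_le_smooth 2 0 0 0 1 1 R).
(* With x and y positive, x + y <= (4 - L) / 2 forces L < 4, which closes the last piece. *)
three_pos_lra (37 / 10 : R) (4 : R) (3 / 40 : R)
  (@ln_le_smooth 0 1 1 2 0 0 R) (@ln_le_smooth 0 0 0 0 2 0 R).
Qed.

Lemma three_pos_slack6 (R : realType) (d L x y : R) :
  5 / 3 <= d -> d <= L -> L <= 711 / 100 -> 0 < x -> 0 < y ->
  x + y + L <= (5 + d) / 2 -> x <= 3 -> y <= 3 ->
  0 <= slack (25 / 161) L + slack (25 / 161) x + slack (25 / 161) y +
    ((25 / 161) * 6 - 1) * (d - 1).
Proof.
move=> d1 dL L711 x0 y0 xyL xT yT.
have [L1|L1] := leP L (19 / 10).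
  three_pos_lra (5 / 3 : R) (19 / 10 : R) (5 / 6 : R)
    (@ln_le_smooth 0 2 0 0 0 1 R) (@ln_le_smooth 0 0 2 5 0 0 R).
have [L2|L2] := leP L (19 / 8).
  three_pos_lra (19 / 10 : R) (19 / 8 : R) (31 / 40 : R)
    (@ln_le_smooth 0 2 0 2 0 0 R) (@ln_le_smooth 1 2 0 0 0 2 R).
have [L3|L3] := leP L (25 / 8).
  three_pos_lra (19 / 8 : R) (25 / 8 : R) (21 / 32 : R)
    (@ln_le_smooth 0 0 2 0 2 0 R) (@ln_le_smooth 0 0 1 0 2 0 R).
have [L4|L4] := leP L (87 / 20).
  three_pos_lra (25 / 8 : R) (87 / 20 : R) (15 / 32 : R)
    (@ln_le_smooth 0 3 0 3 0 0 R) (@ln_le_smooth 0 2 0 0 0 2 R).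
three_pos_lra (87 / 20 : R) (5 : R) (13 / 80 : R)
  (@ln_le_smooth 3 0 1 0 2 0 R) (@ln_le_smooth 2 0 0 0 0 2 R).
Qed.

Lemma three_pos_slack7 (R : realType) (d L x y : R) :
  8 / 7 <= d -> d <= L -> L <= 711 / 100 -> 0 < x -> 0 < y ->
  x + y + L <= (6 + d) / 2 -> x <= (7 / 2) -> y <= (7 / 2) ->
  0 <= slack (80 / 561) L + slack (80 / 561) x + slack (80 / 561) y +
    ((80 / 561) * 7 - 1) * (d - 1).
Proof.
move=> d1 dL L711 x0 y0 xyL xT yT.
have [[_ _ sT _] _] := slack_T R.
have c0 : 0 < (80 / 561) :> R by lra.
have c4 : 4 * (80 / 561) < 1 :> R by lra.
have xs := slack_ge0 c0 c4 sT x0 xT.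
have ys := slack_ge0 c0 c4 sT y0 yT.
have L0 : 0 < L by lra.
have d1L : 8 / 7 <= L by lra.
(* The last term is only -(d - 1) / 561. For small L the slack of L absorbs it, and the slacks of x
   and y are bounded below by 0. *)
have [L1|L1] := leP L (59 / 40).
  have := slack_le_piece (ltW c0) d1L L1.
  have [[] ? ? [] ? ? [] ? ?] := ln235 R.
  have := (@ln_le_smooth 0 0 1 2 0 0 R) L L0.
  lra.
have [L2|L2] := leP L (101 / 40).
  have := slack_le_piece (ltW c0) (ltW L1) L2.
  have [[] ? ? [] ? ? [] ? ?] := ln235 R.
  have := (@ln_le_smooth 0 1 1 3 0 0 R) L L0.
  lra.
clear c0 c4 sT xT yT xs ys.
have [L3|L3] := leP L (15 / 4).
  three_pos_lra (101 / 40 : R) (15 / 4 : R) (139 / 160 : R)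
    (@ln_le_smooth 4 0 0 0 0 1 R) (@ln_le_smooth 4 0 0 0 0 2 R).
have [L4|L4] := leP L (24 / 5).
  three_pos_lra (15 / 4 : R) (24 / 5 : R) (9 / 16 : R)
    (@ln_le_smooth 2 0 0 0 0 0 R) (@ln_le_smooth 0 0 1 2 1 0 R).
have [L5|L5] := leP L (227 / 40).
  three_pos_lra (24 / 5 : R) (227 / 40 : R) (3 / 10 : R)
    (@ln_le_smooth 0 0 1 0 0 0 R) (@ln_le_smooth 1 0 0 0 2 0 R).
three_pos_lra (227 / 40 : R) (6 : R) (13 / 160 : R)
  (@ln_le_smooth 0 2 1 3 0 0 R) (@ln_le_smooth 0 0 0 0 2 0 R).
Qed.

Lemma three_pos_slack8 (R : realType) (d L x y : R) :
  1 <= d -> d <= L -> L <= 711 / 100 -> 0 < x -> 0 < y ->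
  x + y + L <= (7 + d) / 2 -> x <= 4 -> y <= 4 ->
  0 <= slack (12 / 91) L + slack (12 / 91) x + slack (12 / 91) y +
    ((12 / 91) * 8 - 1) * (d - 1).
Proof.
move=> d1 dL L711 x0 y0 xyL xT yT.
have [[_ _ _ sT] _] := slack_T R.
have c0 : 0 < (12 / 91) :> R by lra.
have c4 : 4 * (12 / 91) < 1 :> R by lra.
have xs := slack_ge0 c0 c4 sT x0 xT.
have ys := slack_ge0 c0 c4 sT y0 yT.
have L0 : 0 < L by lra.
(* Here c n > 1, so all four terms are nonnegative as long as L <= T. The same holds for n = 9 and n
   = 10. *)
have [LT|LT] := leP L 4.
  by have := slack_ge0 c0 c4 sT L0 LT; lra.
clear c0 c4 sT xT yT xs ys.
have [L1|L1] := leP L (209 / 40).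
  three_pos_lra (4 : R) (209 / 40 : R) (3 / 4 : R)
    (@ln_le_smooth 3 1 0 0 0 1 R) (@ln_le_smooth 3 0 0 0 1 1 R).
have [L2|L2] := leP L (251 / 40).
  three_pos_lra (209 / 40 : R) (251 / 40 : R) (71 / 160 : R)
    (@ln_le_smooth 4 0 0 0 1 0 R) (@ln_le_smooth 0 0 0 0 1 0 R).
three_pos_lra (251 / 40 : R) (7 : R) (29 / 160 : R)
  (@ln_le_smooth 0 0 2 2 0 0 R) (@ln_le_smooth 2 0 0 0 0 2 R).
Qed.

Lemma three_pos_slack9 (R : realType) (d L x y : R) :
  1 <= d -> d <= L -> L <= 711 / 100 -> 0 < x -> 0 < y ->
  x + y + L <= (8 + d) / 2 -> x <= (9 / 2) -> y <= (9 / 2) ->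
  0 <= slack (7 / 57) L + slack (7 / 57) x + slack (7 / 57) y +
    ((7 / 57) * 9 - 1) * (d - 1).
Proof.
move=> d1 dL L711 x0 y0 xyL xT yT.
have [_ [sT _ _ _]] := slack_T R.
have c0 : 0 < (7 / 57) :> R by lra.
have c4 : 4 * (7 / 57) < 1 :> R by lra.
have xs := slack_ge0 c0 c4 sT x0 xT.
have ys := slack_ge0 c0 c4 sT y0 yT.
have L0 : 0 < L by lra.
have [LT|LT] := leP L (9 / 2).
  by have := slack_ge0 c0 c4 sT L0 LT; lra.
clear c0 c4 sT xT yT xs ys.
have [L1|L1] := leP L (119 / 20).
  three_pos_lra (9 / 2 : R) (119 / 20 : R) (7 / 8 : R)
    (@ln_le_smooth 0 2 1 3 0 0 R) (@ln_le_smooth 0 1 0 0 0 1 R).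
have [L2|L2] := leP L (273 / 40).
  three_pos_lra (119 / 20 : R) (273 / 40 : R) (41 / 80 : R)
    (@ln_le_smooth 5 0 0 0 0 1 R) (@ln_le_smooth 0 2 0 0 0 2 R).
three_pos_lra (273 / 40 : R) (711 / 100 : R) (47 / 160 : R)
  (@ln_le_smooth 0 3 0 2 0 0 R) (@ln_le_smooth 3 0 0 0 3 0 R).
Qed.

Lemma three_pos_slack10 (R : realType) (d L x y : R) :
  1 <= d -> d <= L -> L <= 711 / 100 -> 0 < x -> 0 < y ->
  x + y + L <= (9 + d) / 2 -> x <= 5 -> y <= 5 ->
  0 <= slack (10 / 87) L + slack (10 / 87) x + slack (10 / 87) y +
    ((10 / 87) * 10 - 1) * (d - 1).
Proof.
move=> d1 dL L711 x0 y0 xyL xT yT.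
have [_ [_ sT _ _]] := slack_T R.
have c0 : 0 < (10 / 87) :> R by lra.
have c4 : 4 * (10 / 87) < 1 :> R by lra.
have xs := slack_ge0 c0 c4 sT x0 xT.
have ys := slack_ge0 c0 c4 sT y0 yT.
have L0 : 0 < L by lra.
have [LT|LT] := leP L 5.
  by have := slack_ge0 c0 c4 sT L0 LT; lra.
clear c0 c4 sT xT yT xs ys.
have [L1|L1] := leP L (129 / 20).
  three_pos_lra (5 : R) (129 / 20 : R) (1 : R)
    (@ln_le_smooth 1 1 0 0 0 0 R) (@ln_le_smooth 2 0 1 0 3 0 R).
three_pos_lra (129 / 20 : R) (711 / 100 : R) (51 / 80 : R)
  (@ln_le_smooth 6 0 0 0 2 0 R) (@ln_le_smooth 2 1 0 0 0 2 R).
Qed.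

(** * Spectral theorem for symmetric matrices *)

Lemma char_poly_conj (R : comUnitRingType) n (U V A : 'M[R]_n) :
  U *m V = 1%:M -> char_poly (U *m A *m V) = char_poly A.
Proof.
move=> UV; have VU := mulmx1C UV.
pose P (M : 'M[R]_n) := map_mx (@polyC R) M.
have PUV : P U *m P V = 1%:M by rewrite -map_mxM UV map_mx1.
have -> : char_poly (U *m A *m V) = \det (P U *m char_poly_mx A *m P V).
  rewrite /char_poly /char_poly_mx !map_mxM; congr (\det _).
  rewrite mulmxBr mulmxBl; congr (_ - _).
  by rewrite scalar_mxC -mulmxA PUV mulmx1.
rewrite !det_mulmx mulrAC -det_mulmx PUV det1 mul1r.
by [].
Qed.

Lemma dotmx_ge0 (R : realDomainType) n (v : 'rV[R]_n) : 0 <= (v *m v^T) 0 0.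
Proof. by rewrite mxE sumr_ge0 // => i _; rewrite mxE -expr2 sqr_ge0. Qed.

Lemma dotmx_eq0 (R : realDomainType) n (v : 'rV[R]_n) :
  ((v *m v^T) 0 0 == 0) = (v == 0).
Proof.
apply/idP/eqP => [|->]; last by rewrite mul0mx mxE.
rewrite mxE psumr_eq0 => [/allP v0|i _]; last by rewrite mxE -expr2 sqr_ge0.
apply/rowP => i; have := v0 i (mem_index_enum _).
by rewrite /= !mxE -expr2 sqrf_eq0 => /eqP.
Qed.

Lemma reflection_orthogonal (R : fieldType) n (w : 'rV[R]_n) (c : R) : c != 0 ->
  w *m w^T = c%:M ->
  let Q := 1%:M - (2 / c) *: (w^T *m w) in Q *m Q^T = 1%:M.
Proof.
move=> c0 wE Q; pose P := w^T *m w.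
have PP : P *m P = c *: P.
  by rewrite /P mulmxA -(mulmxA w^T) wE mul_mx_scalar scalemxAl.
have QT : Q^T = Q.
  rewrite /Q -/P; apply/matrixP => i j; rewrite !mxE eq_sym.
  by congr (_ - _ * _); apply: eq_bigr => k _; rewrite !mxE mulrC.
rewrite QT {QT} /Q -/P; move: P PP {wE} => P PP; set a := 2 / c.
rewrite mulmxBl mul1mx mulmxBr mulmx1 -scalemxAl -scalemxAr scalerA PP scalerA.
have -> : a * a * c = a + a by rewrite /a; field.
by rewrite scalerDl opprB addrK subrK.
Qed.

(* A Householder reflection exchanges the first basis vector and v. *)
Lemma orthogonal_completion (R : rcfType) n (v : 'rV[R]_n.+1) : v != 0 ->
  exists Q : 'M[R]_n.+1, Q *m Q^T = 1%:M /\ exists2 a, a != 0 & row 0 Q = a *: v.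
Proof.
move=> v0; pose N := Num.sqrt ((v *m v^T) 0 0).
have vv0 : 0 < (v *m v^T) 0 0 by rewrite lt_def dotmx_eq0 v0 dotmx_ge0.
have N0 : 0 < N by rewrite sqrtr_gt0.
pose u := N^-1 *: v.
have uu : u *m u^T = 1%:M.
  rewrite /u linearZ /= -scalemxAl -scalemxAr scalerA [v *m v^T]mx11_scalar.
  rewrite -(sqr_sqrtr (ltW vv0)) -/N scale_scalar_mx.
  by congr (_ %:M); field; rewrite gt_eqF.
pose e : 'rV[R]_n.+1 := delta_mx 0 0.
have ee : e *m e^T = 1%:M.
  rewrite /e trmx_delta mul_delta_mx.
  by apply/matrixP => i j; rewrite !mxE !ord1.
pose w := u - e.
have [/eqP|w0] := eqVneq w 0.
  rewrite subr_eq0 => /eqP ue; exists 1%:M.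
  split; first by rewrite trmx1 mul1mx.
  exists N^-1; first by rewrite invr_eq0 gt_eqF.
  by rewrite -/u ue row1.
pose c := (w *m w^T) 0 0.
have c0 : c != 0 by rewrite /c dotmx_eq0.
have wE : w *m w^T = c%:M by rewrite [LHS]mx11_scalar.
pose Q := 1%:M - (2 / c) *: (w^T *m w).
exists Q; split; first exact: reflection_orthogonal.
exists N^-1; first by rewrite invr_eq0 gt_eqF.
rewrite -/u rowE -/e /Q mulmxBr mulmx1 -scalemxAr mulmxA.
(* As u and e are unit vectors, c = |u - e|^2 = 2 - 2 (e . u), while e . w = (e . u) - 1. The
   reflection thus sends e to e + w = u. *)
have ew : e *m w^T = (- (c / 2))%:M.
  have cE : c%:M = u *m u^T + e *m e^T - (e *m u^T + (e *m u^T)^T).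
    rewrite -wE /w linearB /= mulmxBl !mulmxBr trmx_mul trmxK.
    by rewrite opprB opprD !addrA [_ - _ + _]addrAC [LHS]addrAC.
  rewrite /w linearB /= mulmxBr ee.
  move: cE; rewrite uu ee [e *m u^T]mx11_scalar; set x := (e *m u^T) 0 0.
  rewrite tr_scalar_mx => /matrixP/(_ 0 0); rewrite !mxE eqxx !mulr1n => ->.
  by apply/matrixP => i j; rewrite !mxE !ord1 eqxx !mulr1n; field.
rewrite ew mul_scalar_mx scalerA.
have -> : 2 / c * - (c / 2) = -1 by field.
by rewrite scaleN1r opprK /w addrC subrK.
Qed.

Lemma char_poly_block_diag (R : comNzRingType) n1 n2 (A : 'M[R]_n1) (B : 'M[R]_n2) :
  char_poly (block_mx A 0 0 B) = char_poly A * char_poly B.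
Proof.
rewrite /char_poly /char_poly_mx map_block_mx !map_mx0 scalar_mx_block.
by rewrite opp_block_mx add_block_mx !oppr0 !addr0 det_ublock.
Qed.

(** By induction on n. The first root x in [s] has an eigenvector; an orthogonal matrix with first
    row along it turns A into a symmetric block matrix with blocks x and B'. Cancelling ['X - x%:P]
    shows that the characteristic polynomial of B' splits over the rest of [s]. *)
Theorem symmetric_diagonalization (R : rcfType) n (A : 'M[R]_n) (s : seq R) :
  A^T = A -> char_poly A = \prod_(x <- s) ('X - x%:P) ->
  exists U : 'M[R]_n, exists lam : 'rV[R]_n,
    U *m U^T = 1%:M /\ U *m A *m U^T = diag_mx lam.
Proof.
elim: n => [|n IHn] in A s *.
  by move=> _ _; exists 0, 0; split; rewrite [LHS]flatmx0 [RHS]flatmx0.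
move=> AT charA.
have : size (char_poly A) = n.+2 by rewrite size_char_poly.
rewrite charA size_prod_XsubC; case: s charA => // x s charA _.
have : eigenvalue A x.
  by rewrite eigenvalue_root_char charA big_cons rootM root_XsubC eqxx.
case/eigenvalueP => v vA v0.
have [Q [QQ [a a0 Qv]]] := orthogonal_completion v0.
have [B BD] : exists B : 'M[R]_(1 + n), B = Q *m A *m Q^T by eexists.
have BT : B^T = B by rewrite BD !trmx_mul trmxK AT mulmxA.
have B0 j : B 0 j = x * (j == 0)%:R.
  have : row 0 B = x *: delta_mx 0 0.
    rewrite BD !row_mul Qv -scalemxAl vA scalerA mulrC -scalerA -Qv.
    by rewrite -scalemxAl -row_mul QQ row1.
  by move/matrixP/(_ 0 j); rewrite !mxE eqxx.
have l0 : lshift n (0 : 'I_1) = 0 :> 'I_n.+1 by apply: val_inj.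
have Bur : ursubmx B = 0.
  by apply/matrixP => i j; rewrite !mxE ord1 l0 B0 mulr0.
have Bdl : dlsubmx B = 0 by rewrite -[B]BT -trmx_ursub Bur trmx0.
have Bul : ulsubmx B = x%:M.
  by apply/matrixP => i j; rewrite !mxE !ord1 l0 B0 mulr1 eqxx mulr1n.
have BE : B = block_mx x%:M 0 0 (drsubmx B).
  by rewrite -{1}[B]submxK Bur Bdl Bul.
have charB' : char_poly (drsubmx B) = \prod_(y <- s) ('X - y%:P).
  apply: (mulfI (monic_neq0 (monicXsubC x))).
  have : char_poly B = char_poly A by rewrite BD; apply: char_poly_conj.
  rewrite charA big_cons {1}BE char_poly_block_diag => <-; congr (_ * _).
  by rewrite /char_poly det_mx11 !mxE eqxx.
have DT : (drsubmx B)^T = drsubmx B by rewrite trmx_drsub BT.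
have [V [lam [VV VB]]] := IHn _ _ DT charB'.
pose W : 'M[R]_(1 + n) := block_mx 1%:M 0 0 V.
have WT : W^T = block_mx 1%:M 0 0 V^T by rewrite tr_block_mx trmx1 !trmx0.
have WW : W *m W^T = 1%:M.
  rewrite WT /W mulmx_block !mulmx0 !mul0mx !addr0 !add0r VV mul1mx.
  by rewrite -scalar_mx_block.
have WB : W *m B *m W^T = diag_mx (row_mx x%:M lam).
  rewrite BE WT /W !mulmx_block !mulmx0 !mul0mx !addr0 !add0r ?mul0mx ?mulmx0.
  rewrite !mul1mx !mulmx1 VB diag_mx_row.
  by congr block_mx; apply/matrixP => i j; rewrite !mxE !ord1.
exists (W *m Q), (row_mx x%:M lam); split.
  by rewrite trmx_mul mulmxA -(mulmxA W) QQ mulmx1.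
by rewrite trmx_mul !mulmxA -(mulmxA W) -(mulmxA W) -BD.
Qed.

(** * Energy and quadratic forms *)

Definition qform (R : nzRingType) n (A : 'M[R]_n) (v : 'rV[R]_n) : R :=
  (v *m A *m v^T) 0 0.

Lemma qformE (R : comNzRingType) n (A : 'M[R]_n) (v : 'rV[R]_n) :
  qform A v = \sum_i \sum_j v 0 i * v 0 j * A i j.
Proof.
rewrite /qform mxE exchange_big /=; apply: eq_bigr => j _.
rewrite !mxE mulr_suml; apply: eq_bigr => i _; ring.
Qed.

Section Diagonalization.
Variables (R : rcfType) (n : nat) (A U : 'M[R]_n) (lam : 'rV[R]_n).
Hypotheses (UU : U *m U^T = 1%:M) (UA : U *m A *m U^T = diag_mx lam).

Lemma diag_spectrum s : char_poly A = \prod_(x <- s) ('X - x%:P) ->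
  perm_eq s [seq lam 0 i | i <- index_enum 'I_n].
Proof.
move=> charA; apply: prod_XsubC_eq; rewrite -charA big_map.
rewrite -(char_poly_conj A UU) UA char_poly_trig ?diag_mx_is_trig //.
by apply: eq_bigr => i _; rewrite mxE eqxx mulr1n.
Qed.

Lemma diag_conjE : A = U^T *m diag_mx lam *m U.
Proof.
have VU := mulmx1C UU.
by rewrite -UA !mulmxA VU mul1mx -mulmxA VU mulmx1.
Qed.

Lemma diag_trace : \tr A = \sum_i lam 0 i.
Proof.
rewrite diag_conjE -mulmxA mxtrace_mulC -mulmxA UU mulmx1.
exact: mxtrace_diag.
Qed.

Lemma diag_trace_sqr : \tr (A *m A) = \sum_i lam 0 i ^+ 2.
Proof.
rewrite {1 2}diag_conjE !mulmxA mxtrace_mulC !mulmxA UU mul1mx.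
rewrite -(mulmxA (diag_mx lam)) UU mulmx1 mulmx_diag mxtrace_diag.
by apply: eq_bigr => i _; rewrite !mxE expr2.
Qed.

Lemma diag_det : \det A = \prod_i lam 0 i.
Proof.
rewrite diag_conjE !det_mulmx mulrAC -det_mulmx.
by rewrite (mulmx1C UU) det1 mul1r det_diag.
Qed.

Lemma qform_diag v : qform A v = \sum_i lam 0 i * (v *m U^T) 0 i ^+ 2.
Proof.
rewrite /qform diag_conjE !mulmxA -(mulmxA _ U).
have -> : U *m v^T = (v *m U^T)^T by rewrite trmx_mul trmxK.
rewrite mxE; apply: eq_bigr => i _; rewrite mul_mx_diag !mxE; ring.
Qed.

Lemma dotmx_diag (v : 'rV[R]_n) :
  (v *m v^T) 0 0 = \sum_i (v *m U^T) 0 i ^+ 2.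
Proof.
have -> : v *m v^T = (v *m U^T) *m (v *m U^T)^T.
  by rewrite trmx_mul trmxK -mulmxA (mulmxA U^T) (mulmx1C UU) mul1mx.
by rewrite mxE; apply: eq_bigr => i _; rewrite !mxE expr2.
Qed.

Lemma qform_le_max M v : (forall i, lam 0 i <= M) ->
  qform A v <= M * (v *m v^T) 0 0.
Proof.
move=> lamM; rewrite qform_diag dotmx_diag mulr_sumr; apply: ler_sum => i _.
by rewrite ler_wpM2r ?sqr_ge0.
Qed.

(* The diagonal entries of U P U^T lie in [0, 1]. *)
Lemma trace_proj_le (P : 'M[R]_n) : P^T = P -> P *m P = P -> \tr A = 0 ->
  2 * \tr (A *m P) <= \sum_i `|lam 0 i|.
Proof.
move=> PT PP trA; pose W := U *m P *m U^T.
have WT : W^T = W by rewrite /W !trmx_mul trmxK PT mulmxA.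
have WW : W *m W = W.
  by rewrite /W !mulmxA -(mulmxA _ U^T) (mulmx1C UU) mulmx1 -(mulmxA U) PP.
have trE : \tr (A *m P) = \sum_i lam 0 i * W i i.
  rewrite diag_conjE -mulmxA -mulmxA mxtrace_mulC -!mulmxA (mulmxA U) -/W.
  by apply: eq_bigr => i _; rewrite mul_diag_mx mxE.
have Wsym i j : W j i = W i j by rewrite -{1}WT mxE.
have Wii i : 0 <= W i i <= 1.
  have : W i i = \sum_j W i j ^+ 2.
    rewrite -{1}WW mxE; apply: eq_bigr => j _.
    by rewrite Wsym expr2.
  rewrite (bigD1 i) //= => Wi.
  have : 0 <= \sum_(j < n | j != i) W i j ^+ 2.
    by apply: sumr_ge0 => j _; exact: sqr_ge0.
  nra.
have -> : \sum_i `|lam 0 i| = \sum_i (`|lam 0 i| + lam 0 i).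
  by rewrite big_split /= -diag_trace trA addr0.
rewrite trE mulr_sumr; apply: ler_sum => i _.
have := Wii i; case: (ger0P (lam 0 i)) => l0 /andP[w0 w1]; nra.
Qed.

(* Some nonzero combination of the rows of V is orthogonal to the eigenvectors
   of index i and j. *)
Lemma negative_combination m (V : 'M[R]_(m.+3, n)) (i j : 'I_n) :
  (forall k, k != i -> k != j -> lam 0 k < 0) ->
  (forall c : 'rV_m.+3, c *m V = 0 -> c = 0) ->
  exists2 c : 'rV_m.+3, c != 0 & qform A (c *m V) < 0.
Proof.
move=> neg Vfree.
pose M : 'M[R]_(m.+3, 2) := \matrix_(k, l) (V *m U^T) k (if l == 0 then i else j).
have : kermx M != 0.
  rewrite kermx_eq0 /row_free; apply/negP => /eqP rM.
  by have := rank_leq_col M; rewrite rM.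
case/rowV0Pn => c /sub_kermxP cM c0; exists c => //.
have cW k l : k = (if l == 0 :> 'I_2 then i else j) -> (c *m V *m U^T) 0 k = 0.
  move=> ->; transitivity ((c *m M) 0 l); last by rewrite cM mxE.
  rewrite -mulmxA [LHS]mxE [RHS]mxE; apply: eq_bigr => p _.
  by rewrite [M p l]mxE.
have ci : (c *m V *m U^T) 0 i = 0 by apply: (cW _ 0).
have cj : (c *m V *m U^T) 0 j = 0 by apply: (cW _ 1).
have x0 : c *m V != 0 by apply: contra c0 => /eqP/Vfree->.
have term0 k : lam 0 k * (c *m V *m U^T) 0 k ^+ 2 <= 0.
  have [->|ki] := eqVneq k i; first by rewrite ci expr0n mulr0.
  have [->|kj] := eqVneq k j; first by rewrite cj expr0n mulr0.
  by rewrite mulr_le0_ge0 ?sqr_ge0 // ltW ?neg.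
rewrite qform_diag lt_def; apply/andP; split; last first.
  by apply: sumr_le0.
rewrite eq_sym -oppr_eq0 -sumrN psumr_eq0; last first.
  by move=> k _; rewrite oppr_ge0.
(* If the form vanished, every term would, and all coordinates of [c *m V] in the eigenbasis would
   be zero. *)
apply/negP => /allP z0; case/eqP: x0.
have : c *m V *m U^T = 0.
  apply/rowP => k; rewrite [RHS]mxE.
  have [->//|ki] := eqVneq k i.
  have [->//|kj] := eqVneq k j.
  have := z0 k (mem_index_enum _).
  by rewrite oppr_eq0 mulf_eq0 (lt_eqF (neg k ki kj)) sqrf_eq0 => /eqP.
move/(congr1 (mulmx^~ U)) => /=; rewrite mul0mx -(mulmxA _ U^T U) (mulmx1C UU) mulmx1.
by [].
Qed.

End Diagonalization.

(* Replacing the entries of an eigenvector by their absolute values does not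
   decrease the quadratic form of a nonnegative matrix in absolute value. *)
Lemma diag_norm_le_max (R : rcfType) n (A U : 'M[R]_n) (lam : 'rV[R]_n) M :
  U *m U^T = 1%:M -> U *m A *m U^T = diag_mx lam -> (forall i j, 0 <= A i j) ->
  (forall i, lam 0 i <= M) -> forall i, `|lam 0 i| <= M.
Proof.
move=> UU UA A0 lamM i.
pose u := row i U.
have uu : (u *m u^T) 0 0 = 1.
  transitivity ((U *m U^T) i i); last by rewrite UU mxE eqxx.
  by rewrite !mxE; apply: eq_bigr => k _; rewrite !mxE.
have uA : qform A u = lam 0 i.
  transitivity ((U *m A *m U^T) i i); last by rewrite UA mxE eqxx mulr1n.
  by rewrite /qform -row_mul !mxE; apply: eq_bigr => k _; rewrite !mxE.
pose w : 'rV[R]_n := \row_j `|u 0 j|.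
have ww : (w *m w^T) 0 0 = 1.
  rewrite -uu !mxE; apply: eq_bigr => k _.
  by rewrite [w^T k 0]mxE [u^T k 0]mxE [w 0 k]mxE -expr2 -normrX ger0_norm ?sqr_ge0.
have := qform_le_max UU UA w lamM; rewrite ww mulr1; apply: le_trans.
rewrite -uA !qformE; apply: (le_trans (ler_norm_sum _ _ _)).
apply: ler_sum => j _; apply: (le_trans (ler_norm_sum _ _ _)).
by apply: ler_sum => k _; rewrite !normrM (ger0_norm (A0 j k)) ![w _ _]mxE.
Qed.

(** * Orthogonal projections onto spans of few vectors *)

Definition orthoproj (R : comNzRingType) n (P : 'M[R]_n) :=
  P^T = P /\ P *m P = P.

Lemma orthoprojD (R : comNzRingType) n (P Q : 'M[R]_n) :
  orthoproj P -> orthoproj Q -> P *m Q = 0 -> orthoproj (P + Q).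
Proof.
move=> [PT PP] [QT QQ] PQ.
have QP : Q *m P = 0 by rewrite -[LHS]trmxK trmx_mul PT QT PQ trmx0.
split; first by apply/matrixP => i j; rewrite -{2}PT -{2}QT !mxE.
by rewrite mulmxDl !mulmxDr PP QQ PQ QP addr0 add0r.
Qed.

Lemma orthoprojB (R : comNzRingType) n (P Q : 'M[R]_n) :
  orthoproj P -> orthoproj Q -> P *m Q = Q -> orthoproj (P - Q).
Proof.
move=> [PT PP] [QT QQ] PQ.
have QP : Q *m P = Q by rewrite -[LHS]trmxK trmx_mul PT QT PQ QT.
split; first by apply/matrixP => i j; rewrite -{2}PT -{2}QT !mxE.
by rewrite mulmxBl !mulmxBr PP QQ PQ QP subrr subr0.
Qed.

Definition proj_line (R : fieldType) n (v : 'rV[R]_n) : 'M[R]_n :=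
  ((v *m v^T) 0 0)^-1 *: (v^T *m v).

Lemma mul_proj_line (R : fieldType) n (v w : 'rV[R]_n) :
  w *m proj_line v = ((w *m v^T) 0 0 / (v *m v^T) 0 0) *: v.
Proof.
rewrite /proj_line -scalemxAr mulmxA [w *m v^T]mx11_scalar mul_scalar_mx scalerA.
by rewrite !mxE eqxx mulr1n mulrC.
Qed.

Lemma orthoproj_line (R : realFieldType) n (v : 'rV[R]_n) :
  v != 0 -> orthoproj (proj_line v).
Proof.
move=> v0; split.
  by apply/matrixP => i j; rewrite !mxE; congr (_ * _); apply: eq_bigr => k _;
     rewrite !mxE mulrC.
rewrite {1}/proj_line -scalemxAl -mulmxA mul_proj_line divff ?dotmx_eq0 //.
by rewrite scale1r.
Qed.

Lemma proj_line_ortho (R : fieldType) n (v w : 'rV[R]_n) :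
  (v *m w^T) 0 0 = 0 -> proj_line v *m proj_line w = 0.
Proof.
move=> vw; rewrite {1}/proj_line -scalemxAl -mulmxA mul_proj_line vw.
by rewrite mul0r scale0r mulmx0 scaler0.
Qed.

Lemma trace_proj_line (R : fieldType) n (A : 'M[R]_n) (v : 'rV[R]_n) :
  \tr (A *m proj_line v) = qform A v / (v *m v^T) 0 0.
Proof.
rewrite /proj_line -scalemxAr mxtraceZ mulmxA mxtrace_mulC mulmxA mulrC.
by rewrite trace_mx11.
Qed.

(** This is the projection onto the orthogonal complement of z inside the span of v1, v2, v3; the
    projection onto that span fixes z. *)
Lemma orthoproj_three_sub (R : realFieldType) n (v1 v2 v3 : 'rV[R]_n) (a b c : R) :
  let z := a *: v1 + b *: v2 + c *: v3 in
  v1 != 0 -> v2 != 0 -> v3 != 0 -> z != 0 ->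
  (v1 *m v2^T) 0 0 = 0 -> (v1 *m v3^T) 0 0 = 0 -> (v2 *m v3^T) 0 0 = 0 ->
  orthoproj (proj_line v1 + proj_line v2 + proj_line v3 - proj_line z).
Proof.
move=> z v10 v20 v30 z0 v12 v13 v23.
have sym (v w : 'rV[R]_n) : (v *m w^T) 0 0 = (w *m v^T) 0 0.
  by rewrite -[v *m w^T]trmxK trmx_mul trmxK mxE.
pose P := proj_line v1 + proj_line v2 + proj_line v3.
have PP : orthoproj P.
  apply: orthoprojD; first apply: orthoprojD; try exact: orthoproj_line.
    exact: proj_line_ortho.
  by rewrite mulmxDl !proj_line_ortho // addr0.
have zP : z *m P = z.
  have self (v : 'rV[R]_n) : v != 0 -> v *m proj_line v = v.
    by move=> v0; rewrite mul_proj_line divff ?dotmx_eq0 // scale1r.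
  have ort (v w : 'rV[R]_n) : (v *m w^T) 0 0 = 0 -> v *m proj_line w = 0.
    by move=> vw; rewrite mul_proj_line vw mul0r scale0r.
  rewrite /P !mulmxDr /z !mulmxDl -!scalemxAl !self //.
  have v21 : (v2 *m v1^T) 0 0 = 0 by rewrite sym.
  have v31 : (v3 *m v1^T) 0 0 = 0 by rewrite sym.
  have v32 : (v3 *m v2^T) 0 0 = 0 by rewrite sym.
  rewrite (ort _ _ v12) (ort _ _ v13) (ort _ _ v21) (ort _ _ v23).
  rewrite (ort _ _ v31) (ort _ _ v32).
  by rewrite !scaler0 !addr0 !add0r.
apply: orthoprojB => //; first exact: orthoproj_line.
have Pz : P *m z^T = z^T by rewrite -{1}PP.1 -trmx_mul zP.
by rewrite /proj_line -scalemxAr mulmxA Pz.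
Qed.

(** * Adjacency matrices *)

Lemma adjmx_tr (R : realType) n (e : rel 'I_n) :
  symmetric e -> (adjmx R e)^T = adjmx R e.
Proof. by move=> se; apply/matrixP => i j; rewrite !mxE se. Qed.

Lemma adjmx_trace (R : realType) n (e : rel 'I_n) :
  irreflexive e -> \tr (adjmx R e) = 0.
Proof. by move=> ie; apply: big1 => i _; rewrite mxE ie. Qed.

Lemma sum_adjmx (R : realType) n (e : rel 'I_n) : simple_graph e ->
  \sum_i \sum_j adjmx R e i j = 2 * (nedges e)%:R.
Proof.
move=> [se ie].
pose S (P : rel 'I_n) : R := \sum_(p : 'I_n * 'I_n) (P p.1 p.2 && e p.1 p.2)%:R.
have SE (P : rel 'I_n) :
    (#|[set p : 'I_n * 'I_n | P p.1 p.2 && e p.1 p.2]|)%:R = S P.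
  rewrite -sum1_card natr_sum /S [RHS](bigID (fun p => P p.1 p.2 && e p.1 p.2)) /=.
  rewrite [X in _ = _ + X]big1 ?addr0 => [|p /negbTE->//].
  by apply: eq_big => p; rewrite ?inE // => ->.
have -> : (nedges e)%:R = S (fun i j => (i < j)%N) by rewrite -SE.
have S' : S (fun i j => (i < j)%N) = S (fun i j => (j < i)%N).
  rewrite /S (reindex_inj (h := fun p : 'I_n * 'I_n => (p.2, p.1))) /=.
    by apply: eq_bigr => p _; rewrite se.
  by move=> [a b] [c d] /= [-> ->].
rewrite mulr_natl mulr2n {2}S' /S -big_split /=.
rewrite pair_bigA /=; apply: eq_bigr => -[i j] _ /=; rewrite mxE.
have [|ji|/val_inj->] := ltngtP i j; rewrite /= ?addr0 ?add0r //.
by rewrite ie.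
Qed.

Lemma adjmx_trace_sqr (R : realType) n (e : rel 'I_n) : simple_graph e ->
  \tr (adjmx R e *m adjmx R e) = 2 * (nedges e)%:R.
Proof.
move=> ge; rewrite -sum_adjmx //; apply: eq_bigr => i _; rewrite mxE.
apply: eq_bigr => j _; rewrite !mxE ge.1.
by case: (e j i); rewrite ?mulr1 ?mulr0.
Qed.

Lemma adjmx_det (R : realType) n (e : rel 'I_n) :
  adjmx R e \in unitmx -> 1 <= `|\det (adjmx R e)|.
Proof.
pose Z : 'M[int]_n := \matrix_(i, j) (e i j)%:R.
have -> : adjmx R e = map_mx intr Z by apply/matrixP => i j; rewrite !mxE rmorph_nat.
rewrite unitmxE det_map_mx unitfE intr_eq0 => d0.
rewrite -intr_norm ler1z -gtz0_ge1 normr_gt0.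
by [].
Qed.

Lemma adjmx_unit_neighbour (R : realType) n (e : rel 'I_n) (i : 'I_n) :
  adjmx R e \in unitmx -> exists j, e i j.
Proof.
move=> uA; apply/existsP; apply: contraT; rewrite negb_exists => /forallP ei.
have : row i (adjmx R e) = 0.
  by apply/rowP => j; rewrite !mxE (negbTE (ei j)).
rewrite rowE => /(congr1 (mulmx^~ (invmx (adjmx R e)))) /=.
rewrite mulmxK // mul0mx => /rowP/(_ i).
by rewrite !mxE !eqxx => /eqP; rewrite oner_eq0.
Qed.

Lemma adjmx_unit_twin (R : realType) n (e : rel 'I_n) (i j : 'I_n) :
  adjmx R e \in unitmx -> e i =1 e j -> i = j.
Proof.
move=> uA eij.
have : row i (adjmx R e) = row j (adjmx R e).
  by apply/rowP => k; rewrite !mxE eij.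
rewrite !rowE => /(congr1 (mulmx^~ (invmx (adjmx R e)))) /=.
rewrite !mulmxK // => /rowP/(_ i); rewrite !mxE !eqxx /=.
by case: eqP => // _ /eqP; rewrite oner_eq0.
Qed.

(** An invertible matrix has no zero row, so every degree is at least 1. *)
Lemma nedges_ge (R : realType) n (e : rel 'I_n) : simple_graph e ->
  adjmx R e \in unitmx -> (n <= 2 * nedges e)%N.
Proof.
move=> ge uA; rewrite -(ler_nat R) natrM -sum_adjmx //.
rewrite -[n in n%:R]card_ord -sum1_card natr_sum; apply: ler_sum => i _.
have [j ij] := adjmx_unit_neighbour i uA.
rewrite (bigD1 j) //= mxE ij lerDl; apply: sumr_ge0 => k _.
by rewrite mxE ler0n.
Qed.

(** Adjacency in the complement graph, called H in the comments. *)
Definition nonadj n (e : rel 'I_n) : rel 'I_n := fun i j => (i != j) && ~~ e i j.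

Lemma adjmx_nonadj (R : realType) n (e : rel 'I_n) i j : irreflexive e ->
  adjmx R e i j = 1 - (i == j)%:R - (nonadj e i j)%:R.
Proof.
move=> ie; rewrite mxE /nonadj; case: eqP => [<-|_] /=.
  by rewrite ie subrr subr0.
by case: (e i j); rewrite /= ?subr0 ?subrr.
Qed.

Lemma nonadj_sym n (e : rel 'I_n) : symmetric e -> symmetric (nonadj e).
Proof. by move=> se i j; rewrite /nonadj eq_sym se. Qed.

Lemma nonadj_irr n (e : rel 'I_n) : irreflexive (nonadj e).
Proof. by move=> i; rewrite /nonadj eqxx. Qed.

(** A is the all-ones matrix minus the identity minus the adjacency matrix of H. *)
Lemma qform_adjmx (R : realType) n (e : rel 'I_n) (v : 'rV[R]_n) :
  irreflexive e ->
  qform (adjmx R e) v = (\sum_i v 0 i) ^+ 2 - \sum_i v 0 i ^+ 2 -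
    \sum_i \sum_j (nonadj e i j)%:R * (v 0 i * v 0 j).
Proof.
move=> ie; rewrite qformE expr2 mulr_suml -!sumrB; apply: eq_bigr => i _.
have -> : v 0 i ^+ 2 = \sum_j (i == j)%:R * (v 0 i * v 0 j).
  rewrite (bigD1 i) //= eqxx mul1r big1 ?addr0 ?expr2 // => j ji.
  by rewrite eq_sym (negbTE ji) mul0r.
rewrite mulr_sumr -!sumrB; apply: eq_bigr => j _.
rewrite adjmx_nonadj //; ring.
Qed.

Lemma sum_nonadj (R : realType) n (e : rel 'I_n) : simple_graph e ->
  \sum_i \sum_j (nonadj e i j)%:R = n%:R * (n%:R - 1) - 2 * (nedges e)%:R :> R.
Proof.
move=> ge; rewrite -sum_adjmx //.
have ->: n%:R * (n%:R - 1) = \sum_(i < n) \sum_(j < n) (1 - (i == j)%:R : R).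
  under eq_bigr => i _.
    rewrite sumrB sumr_const card_ord (bigD1 i) //= eqxx big1 ?addr0; last first.
      by move=> j ji; rewrite eq_sym (negbTE ji).
    over.
  by rewrite sumr_const card_ord mulr_natl.
rewrite -sumrB; apply: eq_bigr => i _; rewrite -sumrB; apply: eq_bigr => j _.
rewrite adjmx_nonadj; [ring|exact: ge.2].
Qed.

(** * Graphs with at most two positive eigenvalues *)

(** A vector of small support, given as a list of vertices with coefficients, so that its quadratic
    form unfolds to a short explicit sum. *)
Definition row_of_seq (R : nzRingType) n (T : seq ('I_n * R)) : 'rV[R]_n :=
  \sum_(p <- T) p.2 *: delta_mx 0 p.1.

Section TwoPositive.
Variables (R : realType) (n : nat) (e : rel 'I_n).
Hypothesis ge : simple_graph e.
Let A := adjmx R e.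
Let h := nonadj e.
Variables (U : 'M[R]_n) (lam : 'rV[R]_n) (i0 j0 : 'I_n).
Hypotheses (UU : U *m U^T = 1%:M) (UA : U *m A *m U^T = diag_mx lam).
Hypothesis neg : forall k, k != i0 -> k != j0 -> lam 0 k < 0.

(* The span of e_u, e_v and w is a three-dimensional subspace on which the
   quadratic form of A is nonnegative. *)
Lemma isotropic_pair_extension (u v k : 'I_n) (w : 'rV[R]_n) :
  h u v -> (w *m A) 0 u = 0 -> (w *m A) 0 v = 0 -> 0 <= qform A w ->
  k != u -> k != v -> w 0 k != 0 -> False.
Proof.
move=> huv wu wv w0 ku kv wk; have [se ie] := ge.
have uv : u != v by case/andP: huv.
have euv : e u v = false by apply/negbTE; case/andP: huv.
pose V : 'M[R]_(3, n) := \matrix_(i < 3, j < n)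
  if i == 0 then (j == u)%:R else if i == 1 then (j == v)%:R else w 0 j.
have VE (c : 'rV[R]_3) j :
    (c *m V) 0 j = c 0 0 * (j == u)%:R + c 0 1 * (j == v)%:R + c 0 2 * w 0 j.
  rewrite !mxE !big_ord_recl big_ord0 !mxE /= addr0 addrA.
  by congr (_ * _ + _ * _ + _ * _); congr (c 0 _); apply: val_inj.
have Vfree (c : 'rV[R]_3) : c *m V = 0 -> c = 0.
  move=> cV; have cVj j : (c *m V) 0 j = 0 by rewrite cV mxE.
  have := cVj k; rewrite VE (negbTE ku) (negbTE kv) !mulr0 !add0r => /eqP.
  rewrite mulf_eq0 (negbTE wk) orbF => /eqP c2.
  have := cVj u; rewrite VE eqxx (negbTE uv) c2 mulr1 mulr0 mul0r !addr0 => c0.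
  have := cVj v; rewrite VE eqxx eq_sym (negbTE uv) c2 mulr1 mulr0 mul0r.
  rewrite add0r addr0 => c1; apply/rowP => -[[|[|[|//]]] i3]; rewrite mxE.
  - by rewrite -[RHS]c0; congr (c 0 _); apply: val_inj.
  - by rewrite -[RHS]c1; congr (c 0 _); apply: val_inj.
  - by rewrite -[RHS]c2; congr (c 0 _); apply: val_inj.
have [c _] := negative_combination UU UA neg Vfree.
pose x := c *m V; rewrite -/x.
have AT : A^T = A by exact: adjmx_tr.
have dot (y z : 'rV[R]_n) : (y *m A *m z^T) 0 0 = \sum_j (y *m A) 0 j * z 0 j.
  by rewrite mxE; apply: eq_bigr => j _; rewrite [z^T _ _]mxE.
have dsum (g : 'I_n -> R) j0' : \sum_j g j * (j == j0')%:R = g j0'.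
  rewrite (bigD1 j0') //= eqxx mulr1 big1 ?addr0 // => j /negbTE->.
  by rewrite mulr0.
have xdot (y : 'rV[R]_n) : (y *m A *m x^T) 0 0 =
    c 0 0 * (y *m A) 0 u + c 0 1 * (y *m A) 0 v + c 0 2 * (y *m A *m w^T) 0 0.
  rewrite !dot -(dsum (fun j => (y *m A) 0 j) u) -(dsum (fun j => (y *m A) 0 j) v).
  rewrite !mulr_sumr -!big_split /=; apply: eq_bigr => j _; rewrite VE; ring.
have symA (y z : 'rV[R]_n) : (y *m A *m z^T) 0 0 = (z *m A *m y^T) 0 0.
  transitivity ((y *m A *m z^T)^T 0 0); first by rewrite [RHS]mxE.
  by rewrite !trmx_mul trmxK AT mulmxA.
have xA p : (x *m A) 0 p = ((delta_mx 0 p : 'rV[R]_n) *m A *m x^T) 0 0.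
  rewrite -symA dot (bigD1 p) //= [delta_mx _ _ _ _]mxE !eqxx mulr1 big1 ?addr0 // => j /negbTE jp.
  by rewrite [delta_mx _ _ _ _]mxE jp andbF mulr0.
have dA p q : ((delta_mx 0 p : 'rV[R]_n) *m A) 0 q = (e p q)%:R by rewrite -rowE !mxE.
have dAw p : ((delta_mx 0 p : 'rV[R]_n) *m A *m w^T) 0 0 = (w *m A) 0 p.
  rewrite symA dot (bigD1 p) //= [delta_mx _ _ _ _]mxE !eqxx mulr1 big1 ?addr0 // => j /negbTE jp.
  by rewrite [delta_mx _ _ _ _]mxE jp andbF mulr0.
(* On the span, e_u and e_v are in the radical of the form: u and v are not adjacent and [w *m A]
   vanishes at both. Only the third coefficient squared times the value at w remains. *)
have xu : (x *m A) 0 u = 0.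
  by rewrite xA xdot !dA dAw wu ie euv !mulr0 !addr0.
have xv : (x *m A) 0 v = 0.
  by rewrite xA xdot !dA dAw wv ie se euv !mulr0 !addr0.
rewrite /qform xdot xu xv !mulr0 !add0r symA xdot wu wv !mulr0 !add0r mulrA.
by rewrite -expr2 ltNge mulr_ge0 ?sqr_ge0.
Qed.

Lemma row_sum_mulA (T : seq ('I_n * R)) j :
  (row_of_seq T *m A) 0 j = \sum_(p <- T) p.2 * (e p.1 j)%:R.
Proof.
rewrite /row_of_seq mulmx_suml summxE; apply: eq_bigr => p _.
by rewrite -scalemxAl -rowE !mxE.
Qed.

Lemma qform_seq (T : seq ('I_n * R)) :
  qform A (row_of_seq T) =
  \sum_(q <- T) q.2 * \sum_(p <- T) p.2 * (e p.1 q.1)%:R.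
Proof.
rewrite /qform {2}/row_of_seq linear_sum /= mulmx_sumr summxE; apply: eq_bigr => q _.
rewrite linearZ /= -scalemxAr mxE trmx_delta; congr (_ * _).
rewrite -row_sum_mulA [LHS]mxE (bigD1 q.1) //= [delta_mx _ _ _ _]mxE !eqxx mulr1.
rewrite big1 ?addr0 // => j /negbTE jq.
by rewrite [delta_mx _ _ _ _]mxE jq mulr0.
Qed.

(** Three mutually non-adjacent vertices span a space on which the form is zero. *)
Lemma nonadj_triangle u v w : h u v -> h u w -> h v w -> False.
Proof.
have [se ie] := ge; rewrite /h /nonadj.
move=> huv /andP[uw euw] /andP[vw evw].
pose T := [:: (w, 1 : R)].
apply: (@isotropic_pair_extension u v w (row_of_seq T)).
- exact: huv.
- by rewrite row_sum_mulA big_seq1 /= se (negbTE euw) mulr0.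
- by rewrite row_sum_mulA big_seq1 /= se (negbTE evw) mulr0.
- by rewrite qform_seq !big_seq1 /= ie !mulr0.
- by rewrite eq_sym.
- by rewrite eq_sym.
- by rewrite /row_of_seq big_seq1 /= !mxE !eqxx mulr1 oner_eq0.
Qed.

Lemma nonadjN u v : u != v -> h u v = false -> e u v = true.
Proof. by rewrite /h /nonadj => -> /negbFE. Qed.

(** The third vector is e_x - e_y: each of u and v is adjacent in the graph to both x and y, so the
    contributions cancel, and the form is zero there since x and y are not adjacent. *)
Lemma nonadj_two_edges u v x y : h u v -> h x y ->
  x != u -> x != v -> y != u -> y != v ->
  h u x = false -> h u y = false -> h v x = false -> h v y = false -> False.
Proof.
have [se ie] := ge.
move=> huv /andP[xy exy] xu xv yu yv hux huy hvx hvy.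
have eux : e x u by rewrite se nonadjN // eq_sym.
have euy : e y u by rewrite se nonadjN // eq_sym.
have evx : e x v by rewrite se nonadjN // eq_sym.
have evy : e y v by rewrite se nonadjN // eq_sym.
pose T := [:: (x, 1 : R); (y, -1)].
apply: (@isotropic_pair_extension u v x (row_of_seq T)) => //.
- rewrite row_sum_mulA /T !big_cons big_nil /= eux euy; ring.
- rewrite row_sum_mulA /T !big_cons big_nil /= evx evy; ring.
- rewrite qform_seq /T !big_cons !big_nil /= !ie (se y x) (negbTE exy).
  by rewrite !(mulr0, addr0).
- rewrite /row_of_seq /T !big_cons big_nil !mxE !eqxx (negbTE xy) /= mulr0 !addr0 mulr1.
  exact: oner_neq0.
Qed.

(** The third vector is e_2 - e_3 + e_4. Its image under A vanishes at v0 and v1, and its form takes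
    the value 2, from the edge joining v2 and v4. *)
Lemma nonadj_five_cycle v0 v1 v2 v3 v4 :
  h v0 v1 -> h v1 v2 -> h v2 v3 -> h v3 v4 -> h v4 v0 ->
  v0 != v2 -> v0 != v3 -> v1 != v3 -> v1 != v4 -> v2 != v4 ->
  h v0 v2 = false -> h v0 v3 = false -> h v1 v3 = false -> h v1 v4 = false ->
  h v2 v4 = false -> False.
Proof.
have [se ie] := ge.
move=> h01 /andP[d12 e12] /andP[d23 e23] /andP[d34 e34] /andP[d40 e40].
move=> d02 d03 d13 d14 d24 h02 h03 h13 h14 h24.
have e02 := nonadjN d02 h02; have e03 := nonadjN d03 h03.
have e13 := nonadjN d13 h13; have e14 := nonadjN d14 h14.
have e24 := nonadjN d24 h24.
pose T := [:: (v2, 1 : R); (v3, -1); (v4, 1)].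
apply: (@isotropic_pair_extension v0 v1 v2 (row_of_seq T)) => //.
- rewrite row_sum_mulA /T !big_cons big_nil /= (se v2) (se v3) e02 e03.
  by rewrite (negbTE e40) /= !(mulr0, mulr1, addr0) subrr.
- rewrite row_sum_mulA /T !big_cons big_nil /= (se v2) (se v3) (se v4) e13 e14.
  by rewrite (negbTE e12) /= !(mulr0, mulr1, addr0, add0r) addNr.
- rewrite qform_seq /T !big_cons !big_nil /= !ie (se v3 v2) (se v4 v2) (se v4 v3).
  rewrite e24 (negbTE e23) (negbTE e34).
  by rewrite !(mulr0, addr0, add0r, mulr1) addr_ge0.
- by rewrite eq_sym.
- by rewrite eq_sym.
- rewrite /row_of_seq /T !big_cons big_nil !mxE !eqxx (negbTE d23) (negbTE d24) /=.
  by rewrite !mulr0 !addr0 mulr1 oner_neq0.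
Qed.

End TwoPositive.

(** Suppose x and y are adjacent non-neighbours of u. Without induced 2 K_2, each neighbour of u is
    adjacent to x or y. If all were adjacent to x, then x, having also the neighbour y, would have
    larger degree than u; likewise for y. So some neighbour v1 misses x and some v2 misses y, and u,
    v2, x, y, v1 is an induced five-cycle, v1 and v2 being non-adjacent for lack of triangles. *)
Lemma max_degree_cononneighbours (T : finType) (h : rel T) (u : T) :
  symmetric h -> irreflexive h ->
  (forall u v w, h u v -> h u w -> h v w -> False) ->
  (forall u v x y, h u v -> h x y -> x != u -> x != v -> y != u -> y != v ->
    h u x = false -> h u y = false -> h v x = false -> h v y = false -> False) ->
  (forall v0 v1 v2 v3 v4,
    h v0 v1 -> h v1 v2 -> h v2 v3 -> h v3 v4 -> h v4 v0 ->
    v0 != v2 -> v0 != v3 -> v1 != v3 -> v1 != v4 -> v2 != v4 ->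
    h v0 v2 = false -> h v0 v3 = false -> h v1 v3 = false -> h v1 v4 = false ->
    h v2 v4 = false -> False) ->
  (forall v, (#|h v| <= #|h u|)%N) ->
  forall x y, h u x = false -> h u y = false -> h x y = false.
Proof.
move=> sh ih tri edges pent umax x y hux huy; apply/negP => hxy.
have neq a b : h a b -> a != b by apply: contraTneq => ->; rewrite ih.
have xu : x != u by apply: contraTneq hxy => ->; rewrite huy.
have yu : y != u by apply: contraTneq hxy => ->; rewrite sh hux.
have vxy v : h u v -> h v x || h v y.
  move=> huv; apply: contraT; rewrite negb_or => /andP[/negbTE hvx /negbTE hvy].
  case: (edges u v x y) => //.
    by apply: contraFneq hux => ->.
  by apply: contraFneq huy => ->.
have notall x' y' : h x' y' -> h u y' = false -> x' != u ->
    (forall v, h u v -> h v x') -> False.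
  move=> hx'y' huy' x'u all; have := umax x'; rewrite leqNgt => /negP; apply.
  apply: proper_card; apply/properP; split.
    by apply/subsetP => v; rewrite !unfold_in => /all; rewrite sh.
  by exists y'; rewrite unfold_in // huy'.
have [v1 huv1 hv1x] : exists2 v, h u v & h v x = false.
  case: (pickP (fun v => h u v && ~~ h v x)) => [v /andP[? /negbTE]|no].
    by exists v.
  case: (notall x y) => // v huv.
  by apply/negPn; have := no v; rewrite huv /= => ->.
have [v2 huv2 hv2y] : exists2 v, h u v & h v y = false.
  case: (pickP (fun v => h u v && ~~ h v y)) => [v /andP[? /negbTE]|no].
    by exists v.
  case: (notall y x) => // [|v huv]; first by rewrite sh.
  by apply/negPn; have := no v; rewrite huv /= => ->.
have hv1y : h v1 y by have := vxy _ huv1; rewrite hv1x.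
have hv2x : h v2 x by have := vxy _ huv2; rewrite hv2y orbF.
have hv2v1 : h v2 v1 = false.
  by apply/negP => h21; case: (tri u v2 v1).
apply: (pent u v2 x y v1) => //.
- by rewrite sh.
- by rewrite sh.
- by rewrite eq_sym.
- by rewrite eq_sym.
- by apply: contraTneq huv2 => ->; rewrite huy.
- by apply: contraTneq hv2x => ->; rewrite hv1x.
- by apply: contraTneq huv1 => <-; rewrite hux.
- by rewrite sh.
Qed.

(** * Vectors constant on {u}, N_H(u) and the remaining vertices *)

Section ThreeClasses.
Variables (R : realType) (n : nat) (e : rel 'I_n).
Hypothesis ge : simple_graph e.
Let A := adjmx R e.
Let h := nonadj e.
Variable u : 'I_n.
Hypothesis indY : forall x y, h u x -> h u y -> h x y = false.
Hypothesis indW : forall x y, h u x = false -> h u y = false -> h x y = false.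
Let b : R := #|h u|%:R.
Let S : R := n%:R * (n%:R - 1) - 2 * (nedges e)%:R.

Definition class_row (x y t : R) : 'rV[R]_n :=
  \row_j (if j == u then x else if nonadj e u j then y else t).

Lemma class_sum (x y t : R) :
  \sum_j (if j == u then x else if h u j then y else t) =
  x + b * y + (n%:R - 1 - b) * t.
Proof.
have huu : h u u = false by exact: nonadj_irr.
have pw j : (if j == u then x else if h u j then y else t) =
    t + (j == u)%:R * (x - t) + (h u j)%:R * (y - t).
  have [->|_] := eqVneq j u; first by rewrite huu /=; ring.
  by case: (h u j); rewrite /= ?mulr1n ?mulr0n ?mul0r ?mul1r ?addr0; ring.
rewrite (eq_bigr _ (fun j _ => pw j)) !big_split /= -!mulr_suml.
rewrite sumr_const card_ord (bigD1 u) //= eqxx big1 => [|j /negbTE->//].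
have -> : \sum_i (h u i)%:R = b :> R.
  rewrite /b -sum1_card natr_sum [LHS](bigID (h u)) /= [X in _ + X]big1.
    by rewrite addr0; apply: eq_bigr => j ->.
  by move=> j /negbTE->.
by rewrite addr0 -[t *+ n]mulr_natl /=; ring.
Qed.

Lemma class_dot (x y t x' y' t' : R) :
  (class_row x y t *m (class_row x' y' t')^T) 0 0 =
  x * x' + b * (y * y') + (n%:R - 1 - b) * (t * t').
Proof.
rewrite -class_sum mxE; apply: eq_bigr => j _; rewrite !mxE.
by rewrite /h; case: eqP => // _; case: ifP.
Qed.

Lemma class_rowD (x y t : R) : class_row x y t =
  x *: class_row 1 0 0 + y *: class_row 0 1 0 + t *: class_row 0 0 1.
Proof.
apply/rowP => j; rewrite !mxE.
by case: eqP => _; [|case: ifP => _]; ring.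
Qed.

Lemma nonadj_row_sum : \sum_i \sum_j (h i j)%:R * (i == u)%:R = b.
Proof.
rewrite (bigD1 u) //= eqxx [X in _ + X]big1 ?addr0; last first.
  by move=> i /negbTE->; rewrite big1 // => j _; rewrite mulr0.
under eq_bigr do rewrite mulr1.
rewrite /b -sum1_card natr_sum [LHS](bigID (h u)) /= [X in _ + X]big1.
  by rewrite addr0; apply: eq_bigr => j ->.
by move=> j /negbTE->.
Qed.

Lemma nonadj_col_sum : \sum_i \sum_j (h i j)%:R * (j == u)%:R = b.
Proof.
rewrite exchange_big -nonadj_row_sum /=; apply: eq_bigr => i _.
by apply: eq_bigr => j _; rewrite /h nonadj_sym //; exact: ge.1.
Qed.

(** By [indY] and [indW] every edge of H joins N_H(u) to its complement: b edges contain u and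
    contribute x y, the other S / 2 - b contribute y t. *)
Lemma qform_class (x y t : R) : qform A (class_row x y t) =
  (x + b * y + (n%:R - 1 - b) * t) ^+ 2 -
  (x ^+ 2 + b * y ^+ 2 + (n%:R - 1 - b) * t ^+ 2) -
  (2 * b * (x * y) + (S - 2 * b) * (y * t)).
Proof.
rewrite qform_adjmx; last exact: ge.2.
congr (_ ^+ 2 - _ - _).
- by rewrite -class_sum; apply: eq_bigr => j _; rewrite mxE.
- have := class_dot x y t x y t; rewrite !expr2 => <-.
  by rewrite [RHS]mxE; apply: eq_bigr => j _; rewrite [X in _ * X]mxE expr2.
have SE := sum_nonadj R ge.
transitivity (\sum_i \sum_j (x * y * ((h i j)%:R * (i == u)%:R + (h i j)%:R * (j == u)%:R)
   + y * t * ((h i j)%:R - (h i j)%:R * (i == u)%:R - (h i j)%:R * (j == u)%:R))).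
  apply: eq_bigr => i _; apply: eq_bigr => j _; rewrite !mxE -/h.
  have sh : symmetric h by apply: nonadj_sym; exact: ge.1.
  have ih : irreflexive h by exact: nonadj_irr.
  case hij: (h i j); last by rewrite /=; ring.
  have [iu|iu] := eqVneq i u; have [ju|ju] := eqVneq j u.
  - by move: hij; rewrite iu ju ih.
  - by move: hij; rewrite iu => -> /=; ring.
  - by move: hij; rewrite ju sh => -> /=; ring.
  - case hui: (h u i); case huj: (h u j); rewrite /=; try ring.
      by move: hij; rewrite indY.
    by move: hij; rewrite indW.
under eq_bigr => i _.
  rewrite big_split /= -!mulr_sumr !sumrB big_split /=.
  over.
rewrite big_split /= -!mulr_sumr !sumrB big_split /=.
by rewrite nonadj_row_sum nonadj_col_sum SE /S; ring.
Qed.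

End ThreeClasses.

Lemma row_neq0 (R : realFieldType) n (v : 'rV[R]_n) : 0 < (v *m v^T) 0 0 -> v != 0.
Proof. by rewrite -dotmx_eq0 => /gt_eqF->. Qed.

Section CliqueBounds.
Variables (R : realType) (n : nat) (e : rel 'I_n).
Hypothesis ge : simple_graph e.
Let A := adjmx R e.
Let h := nonadj e.
Variables (U : 'M[R]_n) (lam : 'rV[R]_n).
Hypotheses (UU : U *m U^T = 1%:M) (UA : U *m A *m U^T = diag_mx lam).
Variable u : 'I_n.
Hypothesis indY : forall x y, h u x -> h u y -> h x y = false.
Hypothesis indW : forall x y, h u x = false -> h u y = false -> h x y = false.
Let b : R := #|h u|%:R.
Let S : R := n%:R * (n%:R - 1) - 2 * (nedges e)%:R.
Let E : R := \sum_i `|lam 0 i|.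

(** Project onto the span of the indicators of N_H(u) and of its complement. These are cliques of
    orders b and n - b, so the trace is (b - 1) + (n - b - 1). *)
Lemma energy_two_cliques : 0 < b -> 2 * (n%:R - 2) <= E.
Proof.
move=> b0; pose v1 : 'rV[R]_n := class_row e u 0 1 0; pose v2 : 'rV[R]_n := class_row e u 1 0 1.
have w0 : 0 <= n%:R - 1 - b.
  have := dotmx_ge0 (class_row e u (0 : R) 0 1); rewrite class_dot.
  by rewrite !(mulr0, mulr1, mul0r, add0r).
have v11 : (v1 *m v1^T) 0 0 = b by rewrite class_dot; ring.
have v22 : (v2 *m v2^T) 0 0 = n%:R - b by rewrite class_dot -/b; ring.
have v12 : (v1 *m v2^T) 0 0 = 0 by rewrite class_dot; ring.
have nb : 0 < n%:R - b by lra.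
have [PT PP] : orthoproj (proj_line v1 + proj_line v2).
  apply: orthoprojD; [apply: orthoproj_line|apply: orthoproj_line|].
  - by apply: row_neq0; rewrite v11.
  - by apply: row_neq0; rewrite v22.
  - exact: proj_line_ortho.
have := trace_proj_le UU UA PT PP (adjmx_trace R ge.2).
rewrite mulmxDr mxtraceD !trace_proj_line v11 v22 /v1 /v2.
rewrite !(qform_class ge indY indW) -/b.
suff -> : ((0 + b * 1 + (n%:R - 1 - b) * 0) ^+ 2 -
    (0 ^+ 2 + b * 1 ^+ 2 + (n%:R - 1 - b) * 0 ^+ 2) -
    (2 * b * (0 * 1) + (n%:R * (n%:R - 1) - 2 * (nedges e)%:R - 2 * b) * (1 * 0))) / b
    + ((1 + b * 0 + (n%:R - 1 - b) * 1) ^+ 2 -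
      (1 ^+ 2 + b * 0 ^+ 2 + (n%:R - 1 - b) * 1 ^+ 2) -
      (2 * b * (1 * 0) + (n%:R * (n%:R - 1) - 2 * (nedges e)%:R - 2 * b) * (0 * 1))) /
      (n%:R - b) = n%:R - 2 by [].
by field; rewrite !gt_eqF.
Qed.

(** Project onto the complement of z in the span of the three class indicators. The span has trace 0
    + (b - 1) + (n - b - 2) = n - 3, from which the Rayleigh quotient of z is subtracted. *)
Lemma energy_three_cliques (x y t : R) : 0 < b -> 0 < n%:R - 1 - b ->
  let N := x ^+ 2 + b * y ^+ 2 + (n%:R - 1 - b) * t ^+ 2 in 0 < N ->
  2 * ((n%:R - 2) * N - (x + b * y + (n%:R - 1 - b) * t) ^+ 2 +
       (2 * b * (x * y) + (S - 2 * b) * (y * t))) <= E * N.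
Proof.
move=> b0 w0 N N0.
pose v1 : 'rV[R]_n := class_row e u 1 0 0; pose v2 : 'rV[R]_n := class_row e u 0 1 0.
pose v3 : 'rV[R]_n := class_row e u 0 0 1; pose z := x *: v1 + y *: v2 + t *: v3.
have zE : z = class_row e u x y t by rewrite class_rowD.
have v11 : (v1 *m v1^T) 0 0 = 1 by rewrite class_dot; ring.
have v22 : (v2 *m v2^T) 0 0 = b by rewrite class_dot -/b; ring.
have v33 : (v3 *m v3^T) 0 0 = n%:R - 1 - b by rewrite class_dot -/b; ring.
have v12 : (v1 *m v2^T) 0 0 = 0 by rewrite class_dot; ring.
have v13 : (v1 *m v3^T) 0 0 = 0 by rewrite class_dot; ring.
have v23 : (v2 *m v3^T) 0 0 = 0 by rewrite class_dot; ring.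
have zz : (z *m z^T) 0 0 = N by rewrite zE class_dot -/b /N; ring.
have [PT PP] := @orthoproj_three_sub R n v1 v2 v3 x y t
  (row_neq0 (eq_ind_r (fun r => 0 < r) ltr01 v11))
  (row_neq0 (eq_ind_r (fun r => 0 < r) b0 v22))
  (row_neq0 (eq_ind_r (fun r => 0 < r) w0 v33))
  (row_neq0 (eq_ind_r (fun r => 0 < r) N0 zz)) v12 v13 v23.
have := trace_proj_le UU UA PT PP (adjmx_trace R ge.2).
rewrite mulmxBr !mulmxDr raddfB /= !mxtraceD !trace_proj_line -/z.
rewrite v11 v22 v33 zz zE /v1 /v2 /v3 !(qform_class ge indY indW) -/b -/S -/E.
rewrite -(ler_pM2r N0); apply: le_trans; rewrite le_eqVlt; apply/orP; left.
apply/eqP; rewrite -/N.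
by field; rewrite !gt_eqF.
Qed.

End CliqueBounds.

(* A triple gives the values on {u}, on N_H(u) and on the other vertices of the
   vector z, orthogonal to which the projection of energy_three_cliques is taken. *)
Definition witnesses : seq (int * int * int) :=
  [:: (4, 1, -2); (6, 3, -2); (4, 1, -5); (2, 1, -1); (1, 1, -1)].

(** With k the number of edges of H, so that d = n - 1 - 2k/n, the inequality is what
    [energy_three_cliques] needs to yield n - 1 + d, after clearing denominators. The condition on y
    makes the norm of the vector positive. *)
Definition witness_ok (n b k : nat) (z : int * int * int) : bool :=
  let: (x, y, t) := z in
  let w := n%:Z - 1 - b%:Z in
  (0 < y) &&
  ((n%:Z - k%:Z) * (x ^+ 2 + b%:Z * y ^+ 2 + w * t ^+ 2) <=
  n%:Z * (2 * b%:Z * (x * y) + 2 * (k%:Z - b%:Z) * (y * t) -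
    (x + b%:Z * y + w * t) ^+ 2)).

(** A finite check. Here b is the maximal degree of H and k its number of edges; k < n is the range
    left over by [energy_two_cliques], and the excluded case is that of [energy_five_degree_two]. *)
Lemma witness_exists (n b k : nat) : (5 <= n <= 9)%N -> (2 <= b <= n - 2)%N ->
  (b <= k < n)%N -> (k <= b ^ 2)%N -> ~~ [&& n == 5, b == 2 & 2 < k]%N ->
  has (witness_ok n b k) witnesses.
Proof.
move=> n59 b2 bk kb2 exc.
have nI : n \in iota 5 5 by rewrite mem_iota.
have bI : b \in iota 2 6 by rewrite mem_iota; move: n59 b2; clear; lia.
have kI : k \in iota 2 7 by rewrite mem_iota; move: n59 b2 bk; clear; lia.
suff /allP/(_ n nI)/allP/(_ b bI)/allP/(_ k kI) : all (fun n => all (fun b => all (fun k =>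
  [&& 2 <= b <= n - 2, b <= k < n, k <= b ^ 2 & ~~ [&& n == 5, b == 2 & 2 < k]]%N
  ==> has (witness_ok n b k) witnesses) (iota 2 7)) (iota 2 6)) (iota 5 5).
  by rewrite b2 bk kb2 exc.
by vm_compute.
Qed.

(** * The energy bound when at most two eigenvalues are positive *)

Section TwoPositiveEnergy.
Variables (R : realType) (n : nat) (e : rel 'I_n).
Hypothesis ge : simple_graph e.
Let A := adjmx R e.
Let h := nonadj e.
Hypothesis uA : A \in unitmx.
Variables (U : 'M[R]_n) (lam : 'rV[R]_n) (i0 j0 : 'I_n).
Hypotheses (UU : U *m U^T = 1%:M) (UA : U *m A *m U^T = diag_mx lam).
Hypothesis neg : forall k, k != i0 -> k != j0 -> lam 0 k < 0.
Let E : R := \sum_i `|lam 0 i|.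

Section MaxDegree.
Variable u : 'I_n.
Hypothesis umax : forall v, (#|h v| <= #|h u|)%N.
Hypothesis u0 : (0 < #|h u|)%N.
Let k := (\sum_(i | h u i) #|h i|)%N.

Let sh : symmetric h. Proof. by apply: nonadj_sym; exact: ge.1. Qed.
Let ih : irreflexive h. Proof. exact: nonadj_irr. Qed.

Lemma max_degree_indY x y : h u x -> h u y -> h x y = false.
Proof.
move=> hux huy; apply/negP => hxy.
exact: (nonadj_triangle ge UU UA neg hux huy hxy).
Qed.

Lemma max_degree_indW x y : h u x = false -> h u y = false -> h x y = false.
Proof.
apply: max_degree_cononneighbours => //.
- by move=> a b c ab ac bc; exact: (nonadj_triangle ge UU UA neg ab ac bc).
- by move=> v w x' y'; apply: (nonadj_two_edges ge UU UA neg).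
- by move=> v0 v1 v2 v3 v4; apply: (nonadj_five_cycle ge UU UA neg).
Qed.

(** Each edge of H has exactly one end in N_H(u), so summing degrees over N_H(u) counts the edges of
    H. *)
Lemma nonadj_count : n%:R * (n%:R - 1) - 2 * (nedges e)%:R = 2 * k%:R :> R.
Proof.
rewrite -(sum_nonadj R ge) /k mulr_natl mulr2n natr_sum.
have cardE i : #|h i|%:R = \sum_j (h i j)%:R :> R.
  rewrite -sum1_card natr_sum [RHS](bigID (h i)) /= [X in _ + X]big1 ?addr0.
    by apply: eq_bigr => j hij; rewrite (_ : h i j = true).
  by move=> j /negbTE->.
transitivity (\sum_i \sum_j ((h u i && h i j)%:R + (h u j && h j i)%:R) : R).
  apply: eq_bigr => i _; apply: eq_bigr => j _; rewrite -/h (sh j i).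
  case hij: (h i j); last by rewrite !andbF /=; ring.
  case hui: (h u i); case huj: (h u j); rewrite /=; try ring.
    by move: hij; rewrite max_degree_indY.
  by move: hij; rewrite max_degree_indW.
transitivity (\sum_i (\sum_j (h u i && h i j)%:R) +
              \sum_i (\sum_j (h u j && h j i)%:R) : R).
  by rewrite -big_split /=; apply: eq_bigr => i _; rewrite -big_split.
rewrite [X in _ + X]exchange_big /=.
have -> : \sum_i \sum_j (h u i && h i j)%:R = \sum_(i | h u i) #|h i|%:R :> R.
  rewrite [RHS]big_mkcond; apply: eq_bigr => i _.
  by case: (h u i); rewrite /= ?cardE // big1.
by [].
Qed.

Lemma nonadj_count_ge : (#|h u| <= k)%N.
Proof.
rewrite -sum1_card /k; apply: leq_sum => i hui.
have hiu : h i u by rewrite sh.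
by apply/card_gt0P; exists u.
Qed.

Lemma nonadj_count_le : (k <= #|h u| ^ 2)%N.
Proof.
rewrite /k -mulnn -sum_nat_const.
by apply: leq_sum => i _; exact: umax.
Qed.

(** If the maximal degree were 1, then u and its only H-neighbour would have the same neighbours in
    the graph, and A would have two equal rows. *)
Lemma max_degree_gt1 : (1 < #|h u|)%N.
Proof.
rewrite ltn_neqAle u0 andbT; apply/negP => /eqP b1.
have [v huvE] := card_gt0P u0; have huv : h u v := huvE.
have uniq a x y : (#|h a| <= 1)%N -> h a x -> h a y -> x = y.
  move=> /card_le1P H ax ay; have := H x ax y.
  by rewrite [RHS]inE (_ : (y \in h a) = true) // => /esym/eqP.
have hu w : h u w = (w == v).
  apply/idP/eqP => [huw|->//]; apply: (uniq u) => //.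
  by move: b1 => <-.
have hv w : h v w = (w == u).
  apply/idP/eqP => [hvw|->]; last by rewrite sh.
  apply: (uniq v) => //; last by rewrite sh.
  by have := umax v; move: b1 => <-.
have twin := @adjmx_unit_twin R n e u v uA.
have uv : u == v = false by apply/negbTE; case/andP: huv.
suff /twin uvE : e u =1 e v by rewrite uvE eqxx in uv.
move=> w.
have [se ie] := ge.
have eE a c : a != c -> e a c = ~~ h a c by move=> ac; rewrite /h /nonadj ac negbK.
have [->|wu] := eqVneq w u.
  by rewrite ie eE ?hv ?eqxx // eq_sym uv.
have [->|wv] := eqVneq w v.
  by rewrite ie eE ?hu ?eqxx // uv.
by rewrite !eE ?hu ?hv 1?eq_sym ?(negbTE wu) ?(negbTE wv) // eq_sym.
Qed.

(** Neither u nor one of its neighbours in the graph lies in N_H(u). *)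
Lemma max_degree_le : (#|h u| + 2 <= n)%N.
Proof.
have [v euv] := adjmx_unit_neighbour u uA.
have uv : u != v by apply: contraTneq euv => <-; rewrite ge.2.
have := cardsC [set w | h u w]; rewrite cardsE card_ord => nE.
suff C2 : (2 <= #|~: [set w | h u w]|)%N.
  by apply: (@leq_trans (#|h u| + #|~: [set w | h u w]|)); rewrite ?leq_add2l ?nE.
have <- : #|[set u; v]| = 2%N by rewrite cards2 uv.
apply: subset_leq_card; apply/subsetP => w; rewrite !inE => /orP[]/eqP->.
  by rewrite ih.
by rewrite /h /nonadj euv andbF.
Qed.

Lemma dot_row_of_seq (T : seq ('I_n * R)) (w : 'rV[R]_n) :
  (row_of_seq T *m w^T) 0 0 = \sum_(p <- T) p.2 * w 0 p.1.
Proof.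
rewrite /row_of_seq mulmx_suml summxE; apply: eq_bigr => p _.
by rewrite -scalemxAl -rowE !mxE.
Qed.

Lemma row_of_seqE (T : seq ('I_n * R)) j :
  row_of_seq T 0 j = \sum_(p <- T) p.2 * (j == p.1)%:R.
Proof. by rewrite /row_of_seq summxE; apply: eq_bigr => p _; rewrite !mxE. Qed.

(* When n = 5 the three-clique bound is too weak if H is the path c, u, a, x or
   the four-cycle u, a, x, c; the vector below has coordinates (1, -2, 2, -1). *)
Lemma energy_five (a c x : 'I_n) : n = 5%N -> h u a -> h u c -> a != c -> h a x ->
  x != u -> k = 3%N \/ k = 4%N /\ h c x ->
  n%:R - 1 + 2 * (nedges e)%:R / n%:R <= E.
Proof.
move=> n5 hua huc ac hax xu kcx; have [se ie] := ge.
have hac : h a c = false by exact: max_degree_indY.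
have hux : h u x = false.
  by apply/negP => hux; have := max_degree_indY hua hux; rewrite hax.
have ua : u != a by case/andP: hua.
have uc : u != c by case/andP: huc.
have ax : a != x by case/andP: hax.
have cx : c != x by apply: contraTneq huc => ->; rewrite hux.
have eE i j : i != j -> e i j = ~~ h i j by move=> ij; rewrite /h /nonadj ij negbK.
pose T := [:: (c, 1 : R); (u, -2); (a, 2); (x, -1)].
pose v := row_of_seq T; pose o : 'rV[R]_n := const_mx 1.
have au : a == u = false by rewrite eq_sym (negbTE ua).
have cu : c == u = false by rewrite eq_sym (negbTE uc).
have ca : c == a = false by rewrite eq_sym (negbTE ac).
have xa : x == a = false by rewrite eq_sym (negbTE ax).
have xc : x == c = false by rewrite eq_sym (negbTE cx).
have ux : u == x = false by rewrite eq_sym (negbTE xu).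
have vv : (v *m v^T) 0 0 = 10.
  rewrite dot_row_of_seq /T !big_cons big_nil /= !row_of_seqE /T !big_cons !big_nil /=.
  rewrite !eqxx au cu ca xa xc ux (negbTE xu) (negbTE ua) (negbTE uc) (negbTE ac).
  by rewrite (negbTE ax) (negbTE cx) /=; ring.
have vo : (v *m o^T) 0 0 = 0.
  by rewrite dot_row_of_seq /T !big_cons big_nil /= !mxE; ring.
have oo : (o *m o^T) 0 0 = n%:R.
  rewrite mxE; under eq_bigr => i _ do rewrite !mxE mulr1.
  by rewrite sumr_const card_ord.
have qo : qform A o = 2 * (nedges e)%:R.
  rewrite qformE -(sum_adjmx R ge); apply: eq_bigr => i _; apply: eq_bigr => j _.
  by rewrite !mxE !mul1r.
have qv : qform A v = 8 - 2 * (e c x)%:R.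
  rewrite qform_seq /T !big_cons !big_nil /= !ie.
  rewrite (se u c) (se a c) (se x c) (se a u) (se x u) (se x a).
  rewrite (eE c u) ?cu // (eE c a) ?ca // (eE u a) // (eE u x) ?ux // (eE a x) //.
  rewrite (sh c u) (sh c a) huc hac hua hux hax /=; ring.
have n0 : 0 < n%:R :> R by rewrite n5.
have [PT PP] : orthoproj (proj_line v + proj_line o).
  apply: orthoprojD; [apply: orthoproj_line|apply: orthoproj_line|].
  - by apply: row_neq0; rewrite vv.
  - by apply: row_neq0; rewrite oo.
  - exact: proj_line_ortho.
(* With q the form at v, this gives E >= q/5 + 2d, where d = 4 - 2k/5. It just suffices: q >= 6 when
   k = 3, and q = 8 when k = 4. *)
have := trace_proj_le UU UA PT PP (adjmx_trace R ge.2).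
rewrite mulmxDr mxtraceD !trace_proj_line vv oo qo qv -/E.
have n5R : n%:R = 5 :> R by rewrite n5.
have := nonadj_count; rewrite n5R => kE.
case: kcx => [k3|[k4 hcx]].
  have : (e c x)%:R <= 1 :> R by case: (e c x).
  move: kE; rewrite k3; set m := (nedges e)%:R; set q := (e c x)%:R; lra.
rewrite (eE c x) // hcx /=.
move: kE; rewrite k4; set m := (nedges e)%:R; lra.
Qed.

Lemma nonadj_second_neighbour (a : 'I_n) : h u a -> #|h a| = 2%N ->
  exists2 x, h a x & x != u.
Proof.
move=> hua a2; have : (0 < #|[set x | h a x] :\ u|)%N.
  have := cardsD1 u [set x | h a x]; rewrite inE sh hua cardsE a2 add1n.
  by case=> <-.
by case/card_gt0P => x; rewrite !inE => /andP[xu hax]; exists x.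
Qed.

(** The degrees of the two neighbours a and c of u add up to k >= 3, so one of them, say a, has a
    second neighbour x. If k = 4, then c has a second neighbour too, and it is x: otherwise the two
    outer edges would form an induced 2 K_2. *)
Lemma energy_five_degree_two : n = 5%N -> #|h u| = 2%N -> (2 < k < 5)%N ->
  n%:R - 1 + 2 * (nedges e)%:R / n%:R <= E.
Proof.
move=> n5 b2 k34.
have /eqP/cards2P[a [c [ac Yac]]] : #|[set w | h u w]| = 2%N by rewrite cardsE.
have huE w : h u w = (w == a) || (w == c).
  by have /setP/(_ w) := Yac; rewrite !inE.
have hua : h u a by rewrite huE eqxx.
have huc : h u c by rewrite huE eqxx orbT.
have kE : k = (#|h a| + #|h c|)%N.
  rewrite /k (bigD1 a) //= (bigD1 c) /=; last by rewrite huc eq_sym.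
  by rewrite big1 ?addn0 // => i /andP[/andP[]]; rewrite huE => /orP[]->.
have := umax a; have := umax c; rewrite b2 => c2 a2.
wlog a2E : a c ac Yac huE hua huc kE c2 a2 / #|h a| = 2%N.
  move=> th; have [a2E|a2E] := eqVneq #|h a| 2%N; first exact: (th a c).
  apply: (th c a) => //; rewrite 1?eq_sym // 1?setUC //; last 2 first.
  - by rewrite addnC.
  - by move: k34 kE a2 c2 a2E; clear; lia.
  by move=> w; rewrite orbC.
have [x hax xu] := nonadj_second_neighbour hua a2E.
apply: (energy_five n5 hua huc ac hax xu).
have [k3|k3] := eqVneq k 3%N; [by left|right].
have c2E : #|h c| = 2%N by move: k34 kE k3 a2E c2; clear; lia.
split; first by rewrite kE a2E c2E.
have [x' hcx' x'u] := nonadj_second_neighbour huc c2E.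
apply/negPn/negP => /negbTE hcx.
have hac : h a c = false by exact: max_degree_indY.
have out y z : h u y -> h y z -> h u z = false.
  by move=> huy hyz; apply/negP => huz; have := max_degree_indY huy huz; rewrite hyz.
have hux := out _ _ hua hax; have hux' := out _ _ huc hcx'.
have xx' : x' != x by apply: contraFneq hcx => <-.
have hax' : h a x' = false.
  apply/negP => hax'; have : (#|[set u; x; x']| <= #|[set y | h a y]|)%N.
    apply: subset_leq_card; apply/subsetP => y; rewrite !inE.
    by move=> /orP[/orP[]|] /eqP-> //; rewrite sh.
  rewrite (cardsE (h a)) a2E setUC cardsU1 !inE negb_or x'u xx' /= cards2 eq_sym xu.
  by [].
have hxx' : h x x' = false by exact: max_degree_indW.
apply: (nonadj_two_edges ge UU UA neg hax hcx') => //.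
- by rewrite eq_sym.
- by apply: contraTneq huc => ->; rewrite -/h hux.
- by apply: contraTneq hua => <-; rewrite hux'.
- by rewrite -/h sh.
Qed.

Lemma energy_max_degree : (5 <= n)%N -> (n <= 9)%N \/ (n <= k)%N ->
  n%:R - 1 + 2 * (nedges e)%:R / n%:R <= E.
Proof.
move=> n5 nk; have n0 : 0 < n%:R :> R by rewrite ltr0n; exact: leq_trans n5.
have kE := nonadj_count.
have dE : 2 * (nedges e)%:R / n%:R = n%:R - 1 - 2 * k%:R / n%:R :> R.
  have -> : 2 * (nedges e)%:R = n%:R * (n%:R - 1) - 2 * k%:R :> R by lra.
  by field; rewrite gt_eqF.
have b0 : 0 < #|h u|%:R :> R by rewrite ltr0n.
(* If k >= n then d <= n - 3, and the bound 2 (n - 2) of two cliques is enough. *)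
rewrite dE; have [nlek|kn] := leqP n k.
  have := energy_two_cliques ge UU UA max_degree_indY max_degree_indW b0.
  have : 1 <= k%:R / n%:R :> R by rewrite ler_pdivlMr // mul1r ler_nat.
  rewrite -/E; lra.
have n9 : (n <= 9)%N by case: nk => // nk; move: nk; rewrite leqNgt kn.
have [/and3P[/eqP n5E /eqP b2 k2]|exc] := boolP [&& n == 5, #|h u| == 2 & 2 < k]%N.
  rewrite -dE; apply: energy_five_degree_two => //.
  by rewrite k2 -n5E.
have b1 := max_degree_gt1; have bn := max_degree_le.
have bk := nonadj_count_ge; have kb := nonadj_count_le.
have : has (witness_ok n #|h u| k) witnesses.
  apply: witness_exists => //; first by rewrite n5.
    by rewrite b1 /=; move: bn; clear; lia.
  by rewrite bk.
case/hasP => -[[x y] t] _ /andP[]; rewrite -(ltr_int R) -(ler_int R).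
rewrite !(rmorphM, rmorphB, rmorphD, rmorphXn, rmorph1) /= -!pmulrn => y0 zW.
pose N : R := x%:~R ^+ 2 + #|h u|%:R * y%:~R ^+ 2 +
  (n%:R - 1 - #|h u|%:R) * t%:~R ^+ 2.
have w0 : 0 < n%:R - 1 - #|h u|%:R :> R.
  by move: bn; rewrite -(ler_nat R) natrD; lra.
have N0 : 0 < N.
  rewrite /N -addrA ltr_wpDl ?sqr_ge0 // ltr_pwDl ?mulr_gt0 ?exprn_gt0 //.
  by rewrite mulr_ge0 ?sqr_ge0 // ltW.
have := energy_three_cliques ge UU UA max_degree_indY max_degree_indW b0 w0 N0.
rewrite kE -/E -/N -(ler_pM2l n0) => EN.
have nN0 : 0 < n%:R * N by rewrite mulr_gt0.
rewrite -(ler_pM2r nN0).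
have -> : (n%:R - 1 + (n%:R - 1 - 2 * k%:R / n%:R)) * (n%:R * N) =
    (2 * n%:R * (n%:R - 1) - 2 * k%:R) * N by field; rewrite gt_eqF.
move: EN zW; rewrite -/N.
set bR : R := #|h u|%:R; set kR : R := k%:R; set nR : R := n%:R.
lra.
Qed.

End MaxDegree.
Theorem energy_two_positive : (5 <= n)%N ->
  (exists u v, h u v) ->
  (n <= 9)%N \/ 2 * n%:R <= n%:R * (n%:R - 1) - 2 * (nedges e)%:R :> R ->
  n%:R - 1 + 2 * (nedges e)%:R / n%:R <= E.
Proof.
move=> n5 [v0 [w0 hvw]] nS.
have [u _ umax] := arg_maxnP (fun v => #|h v|) (isT : xpredT v0).
have {}umax v : (#|h v| <= #|h u|)%N by exact: umax.
have u0 : (0 < #|h u|)%N.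
  by apply: leq_trans (umax v0); apply/card_gt0P; exists w0.
apply: (energy_max_degree umax u0 n5).
case: nS => [|nS]; [by left|right].
by move: nS; rewrite (nonadj_count umax) ler_pM2l // ler_nat.
Qed.

End TwoPositiveEnergy.

(** * The energy bound *)

(* For n = 6 and d <= 4/3 the constant 25/161 is not good enough. *)
Lemma three_pos_slack6_sparse (R : realType) (d L x y : R) :
  1 <= d -> d <= 4 / 3 -> d <= L -> L ^+ 2 <= 6 * d -> 0 < x -> 0 < y ->
  x + y + L <= (5 + d) / 2 -> x <= 5 / 2 -> y <= 5 / 2 ->
  0 <= slack (1 / 6) L + slack (1 / 6) x + slack (1 / 6) y +
    ((1 / 6) * 6 - 1) * (d - 1).
Proof.
move=> d1 d2 dL L6 x0 y0 xyL xT yT.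
have [_ [_ _ sT _]] := slack_T R.
have c0 : 0 < 1 / 6 :> R by lra.
have c4 : 4 * (1 / 6) < 1 :> R by lra.
have xs := slack_ge0 c0 c4 sT x0 xT.
have ys := slack_ge0 c0 c4 sT y0 yT.
have L0 : 0 < L by lra.
(* L^2 <= 6 d <= 8 < (17/6)^2. *)
have L17 : L <= 17 / 6 by nra.
have [LT|/ltW LT] := leP L (5 / 2).
  by have := slack_ge0 c0 c4 sT L0 LT; move: xs ys; clear; lra.
clear c0 c4 sT xT yT xs ys L6.
three_pos_lra (5 / 2 : R) (17 / 6 : R) (1 / 3 : R)
  (@ln_le_smooth 1 0 0 0 0 0 R) (@ln_le_smooth 0 0 0 0 1 0 R).
Qed.

Section GraphEnergy.
Variables (R : realType) (n : nat) (e : rel 'I_n).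
Hypothesis ge : simple_graph e.
Hypothesis n5 : (5 <= n)%N.
Let A : 'M[R]_n := adjmx R e.
Hypothesis uA : A \in unitmx.
Variables (U : 'M[R]_n) (lam : 'rV[R]_n) (i0 : 'I_n).
Hypotheses (UU : U *m U^T = 1%:M) (UA : U *m A *m U^T = diag_mx lam).
Hypothesis imax : forall i, lam 0 i <= lam 0 i0.
Let L : R := lam 0 i0.
Let d : R := 2 * (nedges e)%:R / n%:R.
Let E : R := \sum_i `|lam 0 i|.

Let ones : 'rV[R]_n := const_mx 1.

Let n0 : 0 < n%:R :> R. Proof. by rewrite ltr0n; apply: leq_trans n5. Qed.

Lemma avg_degreeE : n%:R * d = 2 * (nedges e)%:R.
Proof. by rewrite /d mulrC divfK // gt_eqF. Qed.

Lemma avg_degree_ge1 : 1 <= d.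
Proof.
rewrite -(ler_pM2l n0) avg_degreeE mulr1 -natrM ler_nat.
exact: nedges_ge uA.
Qed.

Lemma all_ones_dot : (ones *m ones^T) 0 0 = n%:R.
Proof.
by rewrite mxE; under eq_bigr => i _ do rewrite !mxE mulr1; rewrite sumr_const card_ord.
Qed.

Lemma all_ones_qform : qform A ones = n%:R * d.
Proof.
rewrite avg_degreeE qformE -(sum_adjmx R ge); apply: eq_bigr => i _.
by apply: eq_bigr => j _; rewrite !mxE !mul1r.
Qed.

Lemma avg_degree_le : d <= L.
Proof.
have := qform_le_max UU UA ones imax.
by rewrite all_ones_qform all_ones_dot mulrC ler_pM2r.
Qed.

Lemma sum_lam_sqr : \sum_i lam 0 i ^+ 2 = n%:R * d.
Proof. by rewrite -(diag_trace_sqr UU UA) adjmx_trace_sqr // avg_degreeE. Qed.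

Lemma lam_norm_le i : `|lam 0 i| <= L.
Proof. by apply: (diag_norm_le_max UU UA) => // k l; rewrite mxE ler0n. Qed.

Lemma lam_neq0 i : lam 0 i != 0.
Proof.
have := adjmx_det uA; rewrite (diag_det UU UA) => p1.
have : \prod_i lam 0 i != 0 by rewrite -normr_gt0; apply: lt_le_trans p1.
by move/prodf_neq0; apply.
Qed.

(* The logarithmic terms add up to ln |det A|, which is nonnegative because
   det A is a nonzero integer. *)
Lemma energy_ge_slack c : 2 * c <= 1 ->
  n%:R - 1 + d + \sum_i slack c `|lam 0 i| + (c * n%:R - 1) * (d - 1) <= E.
Proof.
move=> c2; have ln_prod : \sum_i ln `|lam 0 i| = ln `|\det A|.
  rewrite (diag_det UU UA) normr_prod -(big_map (fun i => `|lam 0 i|) xpredT id).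
  rewrite -(big_map (fun i => `|lam 0 i|) xpredT (@ln R)).
  have : all (fun x => 0 < x) [seq `|lam 0 i| | i <- index_enum 'I_n].
    by apply/allP => _ /mapP[i _ ->]; rewrite normr_gt0 lam_neq0.
  elim: [seq _ | _ <- _] => [_|x s IHs /= /andP[x0 s0]]; first by rewrite !big_nil ln1.
  rewrite !big_cons IHs // lnM ?posrE //.
  by elim: s s0 {IHs} => [_|y s IHs /= /andP[y0 /IHs s0]]; rewrite ?big_nil ?big_cons ?mulr_gt0.
have ln0 : 0 <= ln `|\det A| by rewrite ln_ge0 // adjmx_det.
have -> : \sum_i slack c `|lam 0 i| =
    E - n%:R - c * (n%:R * d - n%:R) - (1 - 2 * c) * ln `|\det A|.
  have sum1 : \sum_(i < n) 1 = n%:R :> R by rewrite sumr_const card_ord.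
  rewrite /slack !sumrB -!mulr_sumr sumrB sum1 ln_prod.
  by under [X in _ * (X - _)]eq_bigr => i _ do rewrite -normrX ger0_norm ?sqr_ge0 //;
     rewrite sum_lam_sqr.
have : 0 <= (1 - 2 * c) * ln `|\det A| by rewrite mulr_ge0 // subr_ge0.
lra.
Qed.

Lemma lam_pair_sqr i : i != i0 -> lam 0 i ^+ 2 + L ^+ 2 <= n%:R * d.
Proof.
move=> ii0; rewrite -sum_lam_sqr (bigD1 i0) //= (bigD1 i) //= addrA.
rewrite [lam 0 i ^+ 2 + _]addrC lerDl sumr_ge0 // => j _; exact: sqr_ge0.
Qed.

Lemma lam_norm_le_half i : i != i0 -> `|lam 0 i| <= n%:R / 2.
Proof.
move=> ii0; rewrite -(@ler_pXn2r _ 2) ?nnegrE ?normr_ge0 ?divr_ge0 ?ler0n //.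
rewrite -normrX ger0_norm ?sqr_ge0 //.
have := lam_pair_sqr ii0; have := avg_degree_le; have := avg_degree_ge1.
have := sqr_ge0 (n%:R / 2 - d); nra.
Qed.

Lemma energy_three_positive (c T : R) (j k : 'I_n) :
  0 < c -> 4 * c < 1 -> 0 <= slack c T ->
  (forall i, i != i0 -> `|lam 0 i| <= T) ->
  j != i0 -> k != i0 -> k != j -> 0 < lam 0 j -> 0 < lam 0 k ->
  (forall x y, 0 < x -> 0 < y -> x + y + L <= (n%:R - 1 + d) / 2 ->
     x <= T -> y <= T ->
     0 <= slack c L + slack c x + slack c y + (c * n%:R - 1) * (d - 1)) ->
  n%:R - 1 + d <= E.
Proof.
move=> c0 c4 sT lamT ji ki kj j0 k0 key; rewrite leNgt; apply/negP => Elt.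
have L0 : 0 < L by apply: lt_le_trans avg_degree_le; apply: lt_le_trans avg_degree_ge1.
have split3 (F : 'I_n -> R) :
    \sum_i F i = F i0 + F j + F k + \sum_(i | (i != i0) && (i != j) && (i != k)) F i.
  by rewrite (bigD1 i0) //= (bigD1 j) //= (bigD1 k) ?ki //= !addrA.
(* As the trace vanishes, E is twice the sum of the positive eigenvalues. *)
have Epos : E = \sum_i (`|lam 0 i| + lam 0 i).
  by rewrite big_split /= -(diag_trace UU UA) (adjmx_trace R ge.2) addr0.
have sumE : 2 * (lam 0 j + lam 0 k + L) <= E.
  rewrite Epos split3 !gtr0_norm //.
  suff : 0 <= \sum_(i | (i != i0) && (i != j) && (i != k)) (`|lam 0 i| + lam 0 i).
    by rewrite -/L; lra.
  by apply: sumr_ge0 => i _; case: (ger0P (lam 0 i)) => l0; rewrite ?addNr ?addr_ge0 //.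
have xyL : lam 0 j + lam 0 k + L <= (n%:R - 1 + d) / 2.
  by lra.
have := key _ _ j0 k0 xyL; rewrite -(gtr0_norm j0) -(gtr0_norm k0) !lamT //.
move=> /(_ isT isT); have c2 : 2 * c <= 1 by lra.
have := energy_ge_slack c2; rewrite split3 (gtr0_norm L0).
suff : 0 <= \sum_(i | (i != i0) && (i != j) && (i != k)) slack c `|lam 0 i|.
  by move: Elt; lra.
apply: sumr_ge0 => i /andP[/andP[ii0 _] _].
by apply: (slack_ge0 c0 c4 sT); rewrite ?normr_gt0 ?lam_neq0 ?lamT.
Qed.

Hypothesis L711 : L <= 711 / 100.

Lemma energy_large_order : (11 <= n)%N -> n%:R - 1 + d <= E.
Proof.
move=> n11; have [_ [_ _ _ sT]] := slack_T R.
have c2 : 2 * (1 / 11) <= 1 :> R by lra.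
apply: le_trans (energy_ge_slack c2); rewrite -[leRHS]addrA lerDl addr_ge0 //.
  apply: sumr_ge0 => i _; apply: (slack_ge0 _ _ sT); first lra; first lra.
    by rewrite normr_gt0 lam_neq0.
  exact: le_trans (lam_norm_le i) L711.
rewrite mulr_ge0 // subr_ge0 ?avg_degree_ge1 //.
have : 11 <= n%:R :> R by rewrite (ler_nat R 11).
lra.
Qed.

(** For the complete graph d = n - 1, and the projection onto the all-ones vector gives E >= 2 d. *)
Lemma energy_complete : (forall u v, nonadj e u v = false) -> n%:R - 1 + d <= E.
Proof.
move=> h0; have := sum_nonadj R ge; rewrite big1 => [|i _]; last first.
  by rewrite big1 // => j _; rewrite h0.
rewrite -avg_degreeE -mulrBr => /esym/eqP; rewrite mulf_eq0 gt_eqF //= subr_eq0.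
move=> /eqP dE.
have one0 : ones != 0 by apply: row_neq0; rewrite all_ones_dot.
have [PT PP] := orthoproj_line one0.
have := trace_proj_le UU UA PT PP (adjmx_trace R ge.2).
rewrite trace_proj_line all_ones_qform all_ones_dot -/E mulrAC divff ?gt_eqF //.
by rewrite dE; lra.
Qed.

Lemma energy_small_order : (n <= 10)%N -> n%:R - 1 + d <= E.
Proof.
move=> n10.
have [/existsP[u /existsP[v huv]]|h0] := boolP [exists u, exists v, nonadj e u v];
  last first.
  apply: energy_complete => u v; apply: contraNF h0 => huv.
  by apply/existsP; exists u; apply/existsP; exists v.
(* For n = 10, d <= 7.11 leaves at most 35 edges, so H has at least 45 - 35 = 10 = n. *)
have nS : (n <= 9)%N \/ 2 * n%:R <= n%:R * (n%:R - 1) - 2 * (nedges e)%:R :> R.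
  have [|n9] := leqP n 9; [by left|right].
  have n10R : n%:R = 10 :> R by congr (_%:R); apply/eqP; rewrite eqn_leq n10.
  have := le_trans avg_degree_le L711; have := avg_degreeE; rewrite n10R => dm d7.
  have : (nedges e < 36)%N by rewrite -(ltr_nat R); lra.
  by rewrite ltnS -(ler_nat R); lra.
have huv' : exists u v, nonadj e u v by exists u, v.
have two j : (forall k, k != i0 -> k != j -> ~~ (0 < lam 0 k)) -> n%:R - 1 + d <= E.
  move=> neg; apply: (energy_two_positive ge uA UU UA (i0 := i0) (j0 := j)) => // k ki kj.
  by rewrite lt_neqAle lam_neq0 leNgt neg.
have [/existsP[j /andP[ji j0]]|none] := boolP [exists j, (j != i0) && (0 < lam 0 j)];
  last first.
  (* Taking j = i0 covers the case of a single positive eigenvalue. *)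
  apply: (two i0) => k ki _; apply: contra none => k0.
  by apply/existsP; exists k; rewrite ki.
have [/existsP[k /and3P[ki kj k0]]|none] :=
  boolP [exists k, [&& k != i0, k != j & 0 < lam 0 k]]; last first.
  apply: (two j) => k ki kj; apply: contra none => k0.
  by apply/existsP; exists k; rewrite ki kj.
have d1 := avg_degree_ge1; have dL := avg_degree_le.
have nd := avg_degreeE; have mn := nedges_ge ge uA.
have mn' b : (2 * b < n)%N -> (b < nedges e)%N.
  by move=> bn; rewrite -(@ltn_pmul2l 2) //; exact: leq_trans bn mn.
have lamT := lam_norm_le_half.
have [[sT5 sT6 sT7 sT8] [sT9 sT10 sT6' _]] := slack_T R.
have mR (a : nat) : (a <= nedges e)%N -> a%:R <= (nedges e)%:R :> R by rewrite ler_nat.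
have nE (a : nat) : n = a -> n%:R = a%:R :> R by move->.
have three := energy_three_positive _ _ _ _ ji ki kj j0 k0.
move: n10; rewrite leq_eqVlt => /orP[/eqP nE10|].
  have nR := nE _ nE10.
  apply: (three _ _ _ _ sT10); [lra|lra|by move=> i /lamT; rewrite nR; lra|].
  move=> x y x0 y0; rewrite nR => xyL xT yT; apply: three_pos_slack10 => //.
  lra.
rewrite ltnS leq_eqVlt => /orP[/eqP nE9|].
  have nR := nE _ nE9.
  apply: (three _ _ _ _ sT9); [lra|lra|by move=> i /lamT; rewrite nR|].
  move=> x y x0 y0; rewrite nR => xyL xT yT; apply: three_pos_slack9 => //.
  lra.
rewrite ltnS leq_eqVlt => /orP[/eqP nE8|].
  have nR := nE _ nE8.
  apply: (three _ _ _ _ sT8); [lra|lra|by move=> i /lamT; rewrite nR; lra|].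
  move=> x y x0 y0; rewrite nR => xyL xT yT; apply: three_pos_slack8 => //.
  lra.
rewrite ltnS leq_eqVlt => /orP[/eqP nE7|].
  have nR := nE _ nE7.
  (* For odd n, 2 m >= n improves by parity to 2 m >= n + 1, hence d >= 8/7 here and d >= 6/5 for n
     = 5. *)
  have m4 : (4 <= nedges e)%N by apply: mn'; rewrite nE7.
  apply: (three _ _ _ _ sT7); [lra|lra|by move=> i /lamT; rewrite nR|].
  move=> x y x0 y0; rewrite nR => xyL xT yT; apply: three_pos_slack7 => //.
    by move: nd (mR _ m4); rewrite nR; lra.
  lra.
rewrite ltnS leq_eqVlt => /orP[/eqP nE6|].
  have nR := nE _ nE6.
  have [m4|m5] := leqP (nedges e) 4.
    have d43 : d <= 4 / 3.
      by move: m4; rewrite -(ler_nat R); move: nd; rewrite nR; lra.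
    apply: (three _ _ _ _ sT6'); [lra|lra| |].
      (* 6 d - d^2 is at most 56/9 < 25/4 for d <= 4/3, so T = 5/2 replaces n/2 = 3. *)
      move=> i ii0; rewrite -(@ler_pXn2r _ 2) ?nnegrE //.
      rewrite -normrX ger0_norm ?sqr_ge0 //.
      by have := lam_pair_sqr ii0; rewrite nR; nra.
    move=> x y x0 y0; rewrite nR => xyL xT yT; apply: (three_pos_slack6_sparse (d := d)) => //.
      have := lam_pair_sqr ji; rewrite nR; have := sqr_ge0 (lam 0 j); lra.
    lra.
  apply: (three _ _ _ _ sT6); [lra|lra|by move=> i /lamT; rewrite nR; lra|].
  move=> x y x0 y0; rewrite nR => xyL xT yT; apply: three_pos_slack6 => //.
    by move: nd (mR _ m5); rewrite nR; lra.
  lra.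
rewrite ltnS => n5'.
have nE5 : n = 5%N by apply/eqP; rewrite eqn_leq n5'.
have nR := nE _ nE5.
have m3 : (3 <= nedges e)%N by apply: mn'; rewrite nE5.
apply: (three _ _ _ _ sT5); [lra|lra|by move=> i /lamT; rewrite nR|].
move=> x y x0 y0; rewrite nR => xyL xT yT; apply: three_pos_slack5 => //.
  by move: nd (mR _ m3); rewrite nR; lra.
lra.
Qed.

End GraphEnergy.

Theorem theorem2p1 (R : realType) (n : nat) (e : rel 'I_n) (s : seq R) :
  simple_graph e ->
  (5 <= n)%N ->
  adjmx R e \in unitmx ->
  is_spectrum (adjmx R e) s ->
  (forall x, x \in s -> x <= 711%:R / 100%:R) ->
  (n.-1)%:R + 2 * (nedges e)%:R / n%:R <= energy_of s.
Proof.
move=> ge n5 uA charA sM.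
have [U [lam [UU UA]]] := symmetric_diagonalization (adjmx_tr R ge.1) charA.
have perm_s := diag_spectrum UU UA charA.
have -> : energy_of s = \sum_i `|lam 0 i| by rewrite /energy_of (perm_big _ perm_s) big_map.
have n0 : (0 < n)%N by apply: leq_trans n5.
have -> : n.-1%:R = n%:R - 1 :> R by rewrite -[n in RHS]prednK // -natr1 addrK.
have [i0 _ imax] := arg_maxP (fun i => lam 0 i) (isT : xpredT (Ordinal n0)).
have {}imax i : lam 0 i <= lam 0 i0 by exact: imax.
have L711 : lam 0 i0 <= 711 / 100.
  by apply: sM; rewrite (perm_mem perm_s); apply/mapP; exists i0; rewrite ?mem_index_enum.
have [n10|n11] := leqP n 10.
  exact: (energy_small_order ge n5 uA UU UA imax L711 n10).
exact: (energy_large_order ge n5 uA UU UA imax L711 n11).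
Qed.
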